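(* Let $H=\{x_i\}_{i\in I(H)}$ be a hypergroup with structure constants $\{q_{i,j}^k\}_{i,j,k\in I(H)}$, and let $\mathcal{M}_H=\{\mathcal{M}_k\}_{k\in I(H)}$ be the open quantum random walk on the distance set $I(H)$ derived from $H$, i.e. the one given by $B_{i,j;k}=\sqrt{q_{k,j}^i}\,U_{i,j;k}$ for arbitrarily chosen isometries $U_{i,j;k}$ on $\mathcal{H}$ ($i,j,k\in I(H)$). Then for any state $\rho\in\mathcal{B}_1(\mathcal{H}\otimes\mathcal{K})_{+,1}$ and any tuple $\mathbf{k}=(k_1,\dots,k_n)\in I(H)^n$ with $n\ge 2$, $$p^{(n;\mathbf{k})}=d\left(\sum_{m\in I(H)}q_{k_n,\dots,k_1}^m\,\mathcal{M}_m(\rho)\right),$$ where $p^{(n;\mathbf{k})}=d(\mathcal{M}_{k_n}\circ\cdots\circ\mathcal{M}_{k_1}(\rho))$ and $q_{k_n,\dots,k_1}^m$ are the multi-structure constants of $H$.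
   Context: Notation: $\mathbb{N}=\{1,2,\dots\}$, $\mathbb{N}_0=\mathbb{N}\cup\{0\}$. For a set $S$, $\mathbb{C}S$ is the free complex vector space on $S$. For a Hilbert space $\mathcal{L}$, $\mathcal{B}_1(\mathcal{L})$ is the space of trace class operators and $\mathcal{B}_1(\mathcal{L})_{+,1}=\{X\in\mathcal{B}_1(\mathcal{L}) : X\ge 0,\ \mathrm{Tr}(X)=1\}$ is the set of states. $|\xi\rangle\langle\eta|$ is the rank one operator $\zeta\mapsto\langle\eta,\zeta\rangle\xi$. Hypergroups. Let $H=\{x_i\}_{i\in I(H)}$ be a countable set indexed by $I(H)$, where $I(H)$ is $\{0,\dots,N\}$ for some $N\in\mathbb{N}$ or $\mathbb{N}_0$. Given a binary operation $\circ$ and a map $*$ on $\mathbb{C}H$, the triple $(H,\circ,* )$ is a (discrete) hypergroup if: (1) $*|_H$ maps onto $H$, and $(\mathbb{C}H,\circ,* )$ is an (associative) $*$-algebra with unit $x_0$; (2) for all $i,j\in I(H)$ there are $m\in I(H)$ and $q_{i,j}^0,\dots,q_{i,j}^m\ge 0$ with $\sum_{k=0}^m q_{i,j}^k=1$ and $x_i\circ x_j=\sum_{k=0}^m q_{i,j}^k x_k$ (put $q_{i,j}^k=0$ for $k>m$); (3) for all $i,j\in I(H)$, $q_{i,j}^0\ne 0$ if and only if $x_i=x_j^*$. The numbers $\{q_{i,j}^k\}$ are the structure constants of $H$. For $n\ge2$ and $k_1,\dots,k_n\in I(H)$ the multi-structure constants $q_{k_1,\dots,k_n}^m$ are defined by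 $x_{k_1}\circ x_{k_2}\circ\cdots\circ x_{k_n}=\sum_{m\in I(H)}q_{k_1,\dots,k_n}^mx_m$. Open quantum random walks on distance sets. A distance set $\mathcal{D}$ is either $\{0,\dots,N\}$ for some $N\in\mathbb{N}$ or $\mathbb{N}_0$. Let $\mathcal{K}$ be a Hilbert space with an orthonormal basis $\{|n\rangle\}_{n\in\mathcal{D}}$ and $\mathcal{H}$ a separable Hilbert space. Let $\{B_{i,j;k}\}_{i,j,k\in\mathcal{D}}$ be bounded operators on $\mathcal{H}$ with $\sum_{i\in\mathcal{D}}B_{i,j;k}^*B_{i,j;k}=\mathbf{1}$ (strong operator topology) for all $j,k\in\mathcal{D}$. Put $M_{i,j;k}=B_{i,j;k}\otimes|i\rangle\langle j|$ on $\mathcal{H}\otimes\mathcal{K}$. For $k\in\mathcal{D}$ the map $\mathcal{M}_k(X)=\sum_{i,j\in\mathcal{D}}M_{i,j;k}XM_{i,j;k}^*$ (convergence in trace norm for positive $X\in\mathcal{B}_1(\mathcal{H}\otimes\mathcal{K})$) extends linearly to $\mathcal{B}_1(\mathcal{H}\otimes\mathcal{K})$. The family $\mathcal{M}=\{\mathcal{M}_k\}_{k\in\mathcal{D}}$ is called an open quantum random walk (OQRW) on $\mathcal{D}$. (The operators $B_{i,j;k}=\sqrt{q_{k,j}^i}\,U_{i,j;k}$ with $\mathcal{D}=I(H)$ satisfy the required normalization.) For a state $\rho\in\mathcal{B}_1(\mathcal{H}\otimes\mathcal{K})_{+,1}$ let $\rho_j=U_j^*\rho U_j$, where $U_j:\mathcal{H}\to\mathcal{H}\otimes\mathcal{K}$,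 $U_j\xi=\xi\otimes|j\rangle$. Then $\mathcal{M}_k(\rho)=\sum_{i\in\mathcal{D}}\bigl(\sum_{j\in\mathcal{D}}B_{i,j;k}\rho_jB_{i,j;k}^*\bigr)\otimes|i\rangle\langle i|$ (trace norm convergence), and $\mathcal{M}_k(\rho)$ is again a state. Distribution. For a state of the form $\sigma=\sum_{i\in\mathcal{D}}\sigma_i\otimes|i\rangle\langle i|$ with positive $\sigma_i\in\mathcal{B}_1(\mathcal{H})$, its distribution is $d(\sigma)=(\mathrm{Tr}(\sigma_i))_{i\in\mathcal{D}}$. *)

(* Defs.v *)
From HB Require Import structures.
From mathcomp Require Import all_boot all_order all_algebra.
From mathcomp Require Import finmap complex.
From mathcomp Require Import all_classical all_reals all_analysis.
(* The notations of monalg clash with those of mathcomp-analysis. *)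
From mathcomp Require Import -(notations) monalg.

Set Implicit Arguments.
Unset Strict Implicit.
Unset Printing Implicit Defensive.

Import Order.TTheory GRing.Theory Num.Theory.
Import numFieldNormedType.Exports.

Local Open Scope classical_set_scope.
Local Open Scope complex_scope.
Local Open Scope ring_scope.

(** * Distance sets and hypergroups *)

Inductive distset :=
  | UpTo (N : nat) of (0 < N)%N
  | AllNat.

Definition in_distset (D : distset) (n : nat) : bool :=
  if D is UpTo N _ then (n <= N)%N else true.

Definition idx (D : distset) := {n : nat | in_distset D n}.

Lemma in_distset_down (D : distset) (m n : nat) :
  (m <= n)%N -> in_distset D n -> in_distset D m.
Proof. by case: D => //= N _; exact: leq_trans. Qed.

Lemma in_distset0 (D : distset) : in_distset D 0.
Proof. by case: D. Qed.

Definition idx0 (D : distset) : idx D := exist _ 0%N (in_distset0 D).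

Definition idx_below (D : distset) (m : idx D) (k : 'I_(val m).+1) : idx D :=
  exist _ (k : nat) (in_distset_down (ltn_ord k : (k <= val m)%N) (valP m)).

(* The hypergroup H = {x_i} is identified with its index set through i |-> x_i,
   so that CH is the space of finitely supported functions on [idx D], with
   basis [hx i]. *)
Definition CH (R : realType) (D : distset) := malg (idx D) R[i].

Definition hx (R : realType) (D : distset) (i : idx D) : CH R D := mkmalgU i 1.

Record hypergroup (R : realType) (D : distset) := Hypergroup {
  hop : CH R D -> CH R D -> CH R D;
  hstar : CH R D -> CH R D;
  hstar_basis : hstar @` range (@hx R D) = range (@hx R D);
  hopDl : forall a u v w, hop (a *: u + v) w = a *: hop u w + hop v w;
  hopDr : forall a u v w, hop w (a *: u + v) = a *: hop w u + hop w v;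
  hopA : forall u v w, hop u (hop v w) = hop (hop u v) w;
  hop1l : forall u, hop (hx R (idx0 D)) u = u;
  hop1r : forall u, hop u (hx R (idx0 D)) = u;
  hstarD : forall a u v, hstar (a *: u + v) = a^* *: hstar u + hstar v;
  hstarM : forall u v, hstar (hop u v) = hop (hstar v) (hstar u);
  hstarK : forall u, hstar (hstar u) = u;
  hop_convex : forall i j, exists (m : idx D) (q : nat -> R),
    [/\ forall k, (k <= val m)%N -> 0 <= q k,
        \sum_(k < (val m).+1) q k = 1 &
        hop (hx R i) (hx R j) =
          \sum_(k < (val m).+1) (q k)%:C *: hx R (idx_below k)];
  hop_inv : forall i j,
    mcoeff (idx0 D) (hop (hx R i) (hx R j)) != 0 <-> hx R i = hstar (hx R j)
}.

Definition strconst (R : realType) (D : distset) (H : hypergroup R D)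
    (i j k : idx D) : R[i] :=
  mcoeff k (hop H (hx R i) (hx R j)).

(* For s = [:: k_1; ...; k_n], the coefficient of x_m in
   x_{k_1} o (... o (x_{k_n} o x_0)); recall that x_0 is the unit. *)
Definition multiconst (R : realType) (D : distset) (H : hypergroup R D)
    (s : seq (idx D)) (m : idx D) : R[i] :=
  mcoeff m (foldr (fun i u => hop H (hx R i) u) (hx R (idx0 D)) s).

(** * Hilbert spaces *)

(* The inner product is linear in its second argument. *)
HB.mixin Record isHilbert (R : realType) (V : Type)
    of CompleteNormedModule R[i] V := {
  ip : V -> V -> R[i];
  ipDr : forall a (x y z : V), ip x (a *: y + z) = a * ip x y + ip x z;
  ip_conj : forall x y : V, ip y x = (ip x y)^*;
  ip_norm : forall x : V, ip x x = `|x| ^+ 2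
}.

#[short(type="hilbertType")]
HB.structure Definition Hilbert (R : realType) :=
  {V of isHilbert R V & CompleteNormedModule R[i] V}.

Section Operators.
Context {R : realType}.
Implicit Types V W : hilbertType R.

Definition separable_space V : Prop :=
  exists2 S : set V, countable S & dense S.

Definition lspan V (S : set V) : set V :=
  [set x | exists n (c : 'I_n -> R[i]) (v : 'I_n -> V),
    (forall i, S (v i)) /\ x = \sum_(i < n) c i *: v i].

Definition onbasis V (E : set V) : Prop :=
  (forall x y, E x -> E y -> ip x y = (x == y)%:R) /\ dense (lspan E).

Definition onbasis_family V (J : eqType) (e : J -> V) : Prop :=
  (forall i j, ip (e i) (e j) = (i == j)%:R) /\ dense (lspan (range e)).

Definition bounded_op V W (A : V -> W) : Prop :=
  linear A /\ exists c : R[i], forall x, `|A x| <= c * `|x|.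

Definition isometry_op V W (A : V -> W) : Prop :=
  linear A /\ forall x, `|A x| = `|x|.

(* For bounded A, the only element of this set, by the Riesz theorem. *)
Definition adjoint V W (A : V -> W) : W -> V :=
  get [set B : W -> V | bounded_op B /\ forall x y, ip y (A x) = ip (B y) x].

Definition positive_op V (A : V -> V) : Prop :=
  bounded_op A /\ forall x, 0 <= ip x (A x).

(* Trace of a positive operator, possibly +oo, computed in some orthonormal
   basis; it does not depend on the basis. The sum [\esum] is meant for
   nonnegative terms, so that this is not the trace of a general operator. *)
Definition trace V (A : V -> V) : \bar R :=
  \esum_(x in get (@onbasis V)) (complex.Re (ip x (A x)))%:E.

(* P = |A|, the positive square root of A^* A *)
Definition is_absop V (A P : V -> V) : Prop :=
  positive_op P /\ P \o P = adjoint A \o A.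

Definition absop V (A : V -> V) : V -> V := get (is_absop A).

Definition traceclass V (A : V -> V) : Prop :=
  [/\ bounded_op A, is_absop A (absop A) & (trace (absop A) < +oo)%E].

Definition tracenorm V (A : V -> V) : \bar R := trace (absop A).

Definition is_state V (X : V -> V) : Prop :=
  [/\ traceclass X, positive_op X & trace X = 1%E].

(* Unordered convergence in trace norm. *)
Definition tsum_to V (J : choiceType) (F : J -> V -> V) (S : V -> V) : Prop :=
  forall eps : R, 0 < eps ->
  exists A : {fset J}, forall B : {fset J}, fsubset A B ->
    let E := S - \sum_(j <- B) F j in
    traceclass E /\ (tracenorm E < eps%:E)%E.

Definition tsum V (J : choiceType) (F : J -> V -> V) : V -> V :=
  get [set S : V -> V | bounded_op S /\ tsum_to F S].

(* |x><y| *)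
Definition ketbra V (x y : V) : V -> V := fun z => ip y z *: x.

End Operators.

(** * Tensor products *)

(* A Hilbert space tensor product of H and K, determined up to a unique
   unitary by the axioms below. *)
Record htensor (R : realType) (H K : hilbertType R) := HTensor {
  htensor_sort :> hilbertType R;
  tens : H -> K -> htensor_sort;
  tensDl : forall a x1 x2 y,
    tens (a *: x1 + x2) y = a *: tens x1 y + tens x2 y;
  tensDr : forall a x y1 y2,
    tens x (a *: y1 + y2) = a *: tens x y1 + tens x y2;
  ip_tens : forall x1 x2 y1 y2,
    ip (tens x1 y1) (tens x2 y2) = ip x1 x2 * ip y1 y2;
  tens_dense : dense (lspan [set z | exists x y, z = tens x y])
}.

Definition optens (R : realType) (H K : hilbertType R) (T : htensor H K)
    (A : H -> H) (B : K -> K) : T -> T :=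
  get [set M : T -> T |
    bounded_op M /\ forall x y, M (tens T x y) = tens T (A x) (B y)].

Arguments optens {R H K} T A B.

(** * Open quantum random walks *)

Section OQRW.
Context {R : realType} {D : distset} {H K : hilbertType R}.
Variables (T : htensor H K) (e : idx D -> K).

(* M_k (X) for the walk given by the family B i j k = B_{i,j;k}. The sum
   converges for trace class X when sum_i B_{i,j;k}^* B_{i,j;k} = 1 strongly for
   all j: a trace class X is a linear combination of four positive ones, so the
   unordered sum that converges for positive X also gives the linear extension
   to all X. *)
Definition oqrw (B : idx D -> idx D -> idx D -> H -> H) (k : idx D)
    (X : T -> T) : T -> T :=
  tsum (fun ij : idx D * idx D =>
    let M := optens T (B ij.1 ij.2 k) (ketbra (e ij.1) (e ij.2)) in
    M \o X \o adjoint M).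

(* The operators B_{i,j;k} of the walk derived from a hypergroup. *)
Definition hypergroup_B (G : hypergroup R D)
    (U : idx D -> idx D -> idx D -> H -> H) (i j k : idx D) : H -> H :=
  sqrtC (strconst G k j i) *: U i j k.

Definition is_blocks (sigma : T -> T) (s : idx D -> H -> H) : Prop :=
  (forall i, traceclass (s i) /\ positive_op (s i)) /\
  tsum_to (fun i => optens T (s i) (ketbra (e i) (e i))) sigma.

(* The blocks of sigma are unique when they exist. *)
Definition dist (sigma : T -> T) (i : idx D) : \bar R :=
  trace (get (is_blocks sigma) i).

End OQRW.

(* Main.v *)
(* Put p_i = Tr(U_i^* X U_i). As the U_{i,j;k} are isometries, M_k acts on these
   masses by the nonnegative matrix (q_{k,j}^i)_{i,j}, which is left multiplication
   by x_k on CH. Hence both sides have masses given by the left multiplication by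
   x_{k_n} o ... o x_{k_1}, by associativity of CH; and for a positive block diagonal
   operator of finite trace the masses are the distribution.

   All operators to be summed are positive, so that the trace class theory needed
   is small. If P and E are positive with P^2 = E^2 then P <= E (a maximization of
   <x,(P - E)x>), whence a positive operator of finite trace is its own absolute
   value as far as the trace norm is concerned. Basis independence of the trace
   comes from a Cholesky decomposition of the quadratic form instead of a square
   root, and the sum of a trace-summable family of positive operators is a limit in
   operator norm whose quadratic form is the sum of the quadratic forms. *)

Require Import Defs.
From mathcomp Require Import all_boot all_order all_algebra.
From mathcomp Require Import finmap complex.
From mathcomp Require Import all_classical all_reals all_analysis.
From mathcomp Require Import ring lra.
From mathcomp Require Import -(notations) monalg.
Import Order.TTheory GRing.Theory Num.Theory.
Import numFieldNormedType.Exports.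

Set Implicit Arguments.
Unset Strict Implicit.
Unset Printing Implicit Defensive.

Local Open Scope classical_set_scope.
Local Open Scope ring_scope.

(** * Inner products, Riesz representation and orthonormal bases *)

(** Adjoints, absolute values, tensor products of operators, sums in trace norm, the basis inside
    the trace and the blocks of a state are all values of the choice operator [get]. Before one can
    compute with them, each needs an existence proof, together with uniqueness or an estimate that
    holds for every candidate. Facts about traces are drawn from one inequality: the sum of the
    <phi_i, E phi_i> is at most the trace of E for every finite family phi that satisfies Bessel's
    inequality. Invariance under isometries, the bound of E by its trace and the comparison of the
    total mass with the trace are choices of phi. The initial state need not be block diagonal, so
    its distribution may be meaningless; each step of the walk produces a block diagonal operator.
    The bound by 1 of the column sums of the weights keeps the traces finite, and the right-hand sum
    over m is finite because elements of CH have finite support. *)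

Section ComplexNumbers.
Context {R : realType}.
Implicit Types (z w : R[i]) (a b : R).

(** The squared modulus as an element of [R]; the norm on [R[i]] has its values in [R[i]]. *)
Definition sqn z : R := complex.Re z ^+ 2 + complex.Im z ^+ 2.

Lemma ReD z w : complex.Re (z + w) = complex.Re z + complex.Re w.
Proof. by case: z; case: w. Qed.
Lemma ReN z : complex.Re (- z) = - complex.Re z.
Proof. by case: z. Qed.
Lemma ReB z w : complex.Re (z - w) = complex.Re z - complex.Re w.
Proof. by rewrite ReD ReN. Qed.
Lemma ReZ a z : complex.Re (a%:C%C * z) = a * complex.Re z.
Proof. by case: z => x y /=; rewrite mul0r subr0. Qed.
Lemma Re_conj z : complex.Re z^* = complex.Re z.
Proof. by case: z. Qed.
Lemma Re_sum (I : Type) (s : seq I) (P : pred I) (F : I -> R[i]) :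
  complex.Re (\sum_(i <- s | P i) F i) = \sum_(i <- s | P i) complex.Re (F i).
Proof. by elim/big_rec2: _ => //= i x y _ <-; rewrite ReD. Qed.
Lemma conjCC a : (a%:C%C : R[i])^* = a%:C%C.
Proof. by congr Complex; rewrite oppr0. Qed.
Lemma RealD a b : ((a + b)%:C%C : R[i]) = a%:C%C + b%:C%C.
Proof. by congr Complex; rewrite addr0. Qed.
Lemma RealM a b : ((a * b)%:C%C : R[i]) = a%:C%C * b%:C%C.
Proof. by apply/eqP; rewrite eq_complex /= !(mul0r, mulr0, subr0, addr0) !eqxx. Qed.

Lemma sqn_ge0 z : 0 <= sqn z.
Proof. by rewrite addr_ge0 ?sqr_ge0. Qed.
Lemma sqn_conj z : sqn z^* = sqn z.
Proof. by case: z => a b; rewrite /sqn /= sqrrN. Qed.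
Lemma sqnE z : sqn z = complex.Re (z^* * z).
Proof. by case: z => a b; rewrite /sqn /= mulNr opprK !expr2. Qed.
Lemma conjCM_sqn z : z^* * z = (sqn z)%:C%C.
Proof.
case: z => a b; apply/eqP; rewrite eq_complex /sqn /= mulNr opprK !expr2 eqxx /=.
by rewrite mulNr mulrC subrr.
Qed.
Lemma sqnM z w : sqn (z * w) = sqn z * sqn w.
Proof. by case: z => a b; case: w => c d; rewrite /sqn /=; ring. Qed.
Lemma complex_ge0E z : 0 <= z -> z = (complex.Re z)%:C%C.
Proof. by case: z => a b; rewrite lecE /= => /andP[/eqP -> _]. Qed.
Lemma Re_ge0 z : 0 <= z -> 0 <= complex.Re z.
Proof. by rewrite lecE => /andP[]. Qed.
(** As Re (i z) = - Im z, an identity between expressions linear in a vector x follows from its real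
    part, taken at x and at i x. *)
Lemma complex_eqP z w : complex.Re z = complex.Re w ->
  complex.Re ('i%C * z) = complex.Re ('i%C * w) -> z = w.
Proof.
case: z => a b; case: w => c d /= ->; rewrite !mul0r !mul1r !sub0r.
by move/oppr_inj ->.
Qed.

End ComplexNumbers.

Lemma le_addgt0 {R : realType} (c x y : R) :
  (forall e : R, 0 < e -> x <= y + c * e) -> x <= y.
Proof.
move=> h; apply/ler_addgt0Pr => e e0.
have c1 : 0 < `|c| + 1 by rewrite ltr_wpDl.
apply: (le_trans (h (e / (`|c| + 1)) (divr_gt0 e0 c1))).
rewrite lerD2l mulrA ler_pdivrMr// mulrC ler_pM2l//.
by rewrite (le_trans (ler_norm c))// lerDl.
Qed.

Lemma discr_le {R : realFieldType} (a b c : R) : 0 <= c ->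
  (forall t, 0 <= a + 2 * t * b + t ^+ 2 * c) -> b ^+ 2 <= a * c.
Proof.
rewrite le_eqVlt => /orP[/eqP<- | c0] h.
  (* For c = 0 the form is affine in t; if b were nonzero it would take the value -1 at the chosen
     t. *)
  rewrite mulr0; have [->|b0] := eqVneq b 0; first by rewrite expr0n.
  have := h (- (a + 1) / (2 * b)); rewrite mulr0 addr0.
  suff -> : a + 2 * (- (a + 1) / (2 * b)) * b = -1 by rewrite oppr_ge0 ler10.
  by field.
rewrite -subr_ge0; have := h (- b / c); rewrite -(ler_pM2r c0) mul0r.
suff -> : (a + 2 * (- b / c) * b + (- b / c) ^+ 2 * c) * c = a * c - b ^+ 2 by [].
by field; rewrite gt_eqF.
Qed.

Lemma inv_succ_lt {R : realType} (e : R) : 0 < e ->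
  exists N, forall n, (N <= n)%N -> n.+1%:R^-1 < e.
Proof.
move=> e0; have [N hN] := ltr_add_invr (y := 0) (x := e) e0.
exists N => n Nn; rewrite add0r in hN; apply: le_lt_trans hN.
by rewrite lef_pV2 ?posrE ?ltr0n// ler_nat ltnS.
Qed.

Section Hilbert.
Context {R : realType}.
Implicit Types V W : hilbertType R.

(* ip and the norm are valued in R[i]; the estimates use these real versions. *)
Definition rip {V} (x y : V) : R := complex.Re (ip x y).
Definition nrm {V} (x : V) : R := complex.Re `|x|.

Section Basic.
Context {V : hilbertType R}.
Implicit Types (x y z : V) (a : R[i]).

Lemma normE x : `|x| = (nrm x)%:C%C.
Proof. exact/complex_ge0E/normr_ge0. Qed.
Lemma nrm_ge0 x : 0 <= nrm x.
Proof. exact/Re_ge0/normr_ge0. Qed.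
Lemma ip0r x : ip x 0 = 0.
Proof. by have := ipDr (-1) x 0 0; rewrite scaler0 addr0 mulN1r addNr. Qed.
Lemma ipD x y z : ip x (y + z) = ip x y + ip x z.
Proof. by have := ipDr 1 x y z; rewrite scale1r mul1r. Qed.
Lemma ipZ a x y : ip x (a *: y) = a * ip x y.
Proof. by have := ipDr a x y 0; rewrite !addr0 ip0r addr0. Qed.
Lemma ipN x y : ip x (- y) = - ip x y.
Proof. by rewrite -scaleN1r ipZ mulN1r. Qed.
Lemma ipB x y z : ip x (y - z) = ip x y - ip x z.
Proof. by rewrite ipD ipN. Qed.
Lemma ip0l x : ip 0 x = 0.
Proof. by rewrite ip_conj ip0r rmorph0. Qed.
Lemma ipDl x y z : ip (x + y) z = ip x z + ip y z.
Proof. by rewrite ip_conj (ip_conj z x) (ip_conj z y) ipD rmorphD. Qed.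
Lemma ipZl a x y : ip (a *: x) y = a^* * ip x y.
Proof. by rewrite ip_conj (ip_conj y x) ipZ rmorphM. Qed.
Lemma ipNl x y : ip (- x) y = - ip x y.
Proof. by rewrite ip_conj (ip_conj y x) ipN rmorphN. Qed.
Lemma ipBl x y z : ip (x - y) z = ip x z - ip y z.
Proof. by rewrite ipDl ipNl. Qed.
Lemma ip_sumr (I : Type) (s : seq I) (P : pred I) (F : I -> V) x :
  ip x (\sum_(i <- s | P i) F i) = \sum_(i <- s | P i) ip x (F i).
Proof. by elim/big_rec2: _ => [|i u v _ <-]; rewrite ?ip0r ?ipD. Qed.
Lemma ip_suml (I : Type) (s : seq I) (P : pred I) (F : I -> V) x :
  ip (\sum_(i <- s | P i) F i) x = \sum_(i <- s | P i) ip (F i) x.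
Proof. by elim/big_rec2: _ => [|i u v _ <-]; rewrite ?ip0l ?ipDl. Qed.

Lemma ripC x y : rip x y = rip y x.
Proof. by rewrite /rip ip_conj Re_conj. Qed.
Lemma ripDr x y z : rip x (y + z) = rip x y + rip x z.
Proof. by rewrite /rip ipD ReD. Qed.
Lemma ripDl x y z : rip (x + y) z = rip x z + rip y z.
Proof. by rewrite /rip ipDl ReD. Qed.
Lemma ripNr x y : rip x (- y) = - rip x y.
Proof. by rewrite /rip ipN ReN. Qed.
Lemma ripNl x y : rip (- x) y = - rip x y.
Proof. by rewrite /rip ipNl ReN. Qed.
Lemma ripBr x y z : rip x (y - z) = rip x y - rip x z.
Proof. by rewrite ripDr ripNr. Qed.
Lemma ripBl x y z : rip (x - y) z = rip x z - rip y z.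
Proof. by rewrite ripDl ripNl. Qed.
Lemma ripZr (a : R) x y : rip x (a%:C%C *: y) = a * rip x y.
Proof. by rewrite /rip ipZ ReZ. Qed.
Lemma ripZl (a : R) x y : rip (a%:C%C *: x) y = a * rip x y.
Proof. by rewrite ripC ripZr ripC. Qed.
Lemma ip_diag x : ip x x = (nrm x ^+ 2)%:C%C.
Proof. by rewrite ip_norm normE !expr2 RealM. Qed.
Lemma rip_diag x : rip x x = nrm x ^+ 2.
Proof. by rewrite /rip ip_diag. Qed.
Lemma nrm0 : nrm (0 : V) = 0.
Proof. by rewrite /nrm normr0. Qed.
Lemma nrm_eq0 x : nrm x = 0 -> x = 0.
Proof. by move=> h; apply/normr0_eq0; rewrite normE h. Qed.
Lemma nrmN x : nrm (- x) = nrm x.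
Proof. by rewrite /nrm normrN. Qed.
Lemma nrmB x y : nrm (x - y) = nrm (y - x).
Proof. by rewrite /nrm distrC. Qed.
Lemma nrmD_le x y : nrm (x + y) <= nrm x + nrm y.
Proof. by rewrite -lecR RealD -!normE ler_normD. Qed.
Lemma nrmZ a x : nrm (a *: x) ^+ 2 = sqn a * nrm x ^+ 2.
Proof.
by rewrite -!rip_diag /rip ipZl ipZ mulrA conjCM_sqn ReZ.
Qed.
Lemma nrmZr (a : R) x : nrm (a%:C%C *: x) = `|a| * nrm x.
Proof.
apply/eqP; rewrite -(@eqrXn2 _ 2) ?nrm_ge0 ?mulr_ge0 ?nrm_ge0//.
by rewrite nrmZ exprMn real_normK ?num_real// /sqn /= expr0n addr0.
Qed.
Lemma nrm_sqrD x y : nrm (x + y) ^+ 2 = nrm x ^+ 2 + 2 * rip x y + nrm y ^+ 2.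
Proof. by rewrite -!rip_diag ripDr !ripDl (ripC y x); ring. Qed.
Lemma nrm_sqrB x y : nrm (x - y) ^+ 2 = nrm x ^+ 2 - 2 * rip x y + nrm y ^+ 2.
Proof. by rewrite nrm_sqrD nrmN ripNr; ring. Qed.

Lemma CS_rip x y : rip x y ^+ 2 <= nrm x ^+ 2 * nrm y ^+ 2.
Proof.
apply: discr_le; rewrite ?sqr_ge0// => t.
suff <- : nrm (x + t%:C%C *: y) ^+ 2 =
  nrm x ^+ 2 + 2 * t * rip x y + t ^+ 2 * nrm y ^+ 2 by rewrite sqr_ge0.
by rewrite nrm_sqrD ripZr nrmZr exprMn real_normK ?num_real// mulrA.
Qed.
Lemma rip_le x y : rip x y <= nrm x * nrm y.
Proof.
rewrite (le_trans (ler_norm _))// -ler_sqr ?nnegrE ?mulr_ge0 ?nrm_ge0//.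
by rewrite real_normK ?num_real// exprMn CS_rip.
Qed.

Lemma ip_ext x y : (forall z, rip z x = rip z y) -> x = y.
Proof.
move=> h; apply/subr0_eq/nrm_eq0/eqP; rewrite -sqrf_eq0 -rip_diag.
by rewrite ripBr h subrr.
Qed.
(** Replacing y by -i y turns the real part of <y, x> into minus its imaginary part. *)
Lemma rip0_ip0 (S : set V) x : (forall (a : R[i]) y, S y -> S (a *: y)) ->
  (forall y, S y -> rip y x = 0) -> forall y, S y -> ip y x = 0.
Proof.
move=> SZ h y Sy; apply: complex_eqP => /=; first exact: h.
have e : (- 'i%C : R[i])^* = 'i%C by congr Complex; rewrite ?oppr0 ?opprK.
have := h _ (SZ (-'i%C) _ Sy); by rewrite /rip ipZl e => ->; rewrite ?mulr0 ?subr0 ?mul0r.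
Qed.
End Basic.
End Hilbert.

Section LinearMaps.
Context {R : realType} {V W : hilbertType R} {A : V -> W}.
Hypothesis hA : linear A.
Lemma lin0 : A 0 = 0.
Proof. by have := hA (-1) 0 0; rewrite scaler0 addr0 scaleN1r addNr. Qed.
Lemma linD x y : A (x + y) = A x + A y.
Proof. by have := hA 1 x y; rewrite !scale1r. Qed.
Lemma linZ a x : A (a *: x) = a *: A x.
Proof. by have := hA a x 0; rewrite !addr0 lin0 addr0. Qed.
Lemma linN x : A (- x) = - A x.
Proof. by rewrite -scaleN1r linZ scaleN1r. Qed.
Lemma linB x y : A (x - y) = A x - A y.
Proof. by rewrite linD linN. Qed.
Lemma lin_sum (I : Type) (s : seq I) (P : pred I) (F : I -> V) :
  A (\sum_(i <- s | P i) F i) = \sum_(i <- s | P i) A (F i).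
Proof. by elim/big_rec2: _ => [|i u v _ <-]; rewrite ?lin0 ?linD. Qed.
End LinearMaps.

(** * Completeness, density and minimization over subspaces *)

Section Topology.
Context {R : realType}.
Implicit Types V W : hilbertType R.

Lemma bounded_opP V W (A : V -> W) :
  bounded_op A <-> linear A /\ exists2 c : R, 0 <= c & forall x, nrm (A x) <= c * nrm x.
Proof.
split=> [[lA [c hc]]|[lA [c c0 hc]]]; split=> //; last first.
  by exists c%:C%C => x; rewrite !normE -RealM lecR.
exists `|complex.Re c| => // x; have := hc x; rewrite !normE mulrC.
rewrite lecE => /andP[_]; rewrite ReZ mulrC => /le_trans; apply.
by rewrite ler_wpM2r ?nrm_ge0// ler_norm.
Qed.

Lemma bounded_op_lin V W (A : V -> W) : bounded_op A -> linear A.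
Proof. by case. Qed.

Lemma cauchy_limit V (u : nat -> V) :
  (forall e : R, 0 < e -> exists N, forall m n, (N <= m)%N -> (N <= n)%N ->
    nrm (u m - u n) < e) ->
  exists l, forall e : R, 0 < e -> exists N, forall n, (N <= n)%N -> nrm (u n - l) < e.
Proof.
move=> hu.
have : cauchy (u @ \oo).
  apply/cauchy_ballP => e e0.
  have e0' : 0 < complex.Re e by move: e0; rewrite ltcE => /andP[].
  have eE : e = (complex.Re e)%:C%C by apply/complex_ge0E/ltW.
  have [N hN] := hu _ e0'.
  exists (u @` [set n | (N <= n)%N], u @` [set n | (N <= n)%N]) => /=.
    by split; exists N => // n; exists n.
  move=> [_ _] /= [[m hm <-] [n hn <-]]; rewrite -ball_normE /= normE eE ltcR.
  exact: hN.
move=> /cauchy_cvgP /cvg_ex [l hl]; exists l => e e0.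
have e0' : (0 : R[i]) < e%:C%C by rewrite ltcR.
move/cvg_ballP: hl => /(_ _ e0') [N _ hN]; exists N => n hn.
have := hN n hn; rewrite -ball_normE /= normE ltcR nrmB.
exact.
Qed.

Lemma dense_approx V (S : set V) : dense S ->
  forall (x : V) (e : R), 0 < e -> exists2 s, S s & nrm (x - s) < e.
Proof.
move=> dS x e e0; have e0' : (0 : R[i]) < e%:C%C by rewrite ltcR.
have [|s [bs Ss]] := dS (ball x e%:C%C) _ (ball_open x e%:C%C).
  by exists x; exact: ballxx.
by exists s => //; move: bs; rewrite -ball_normE /= normE ltcR.
Qed.

Lemma approx_dense V (S : set V) :
  (forall (x : V) (e : R), 0 < e -> exists2 s, S s & nrm (x - s) < e) -> dense S.
Proof.
move=> h O [x Ox] oO; have : nbhs x O by move: oO; rewrite openE; exact.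
move=> /nbhs_ballP [e /= e0 he].
have e0' : 0 < complex.Re e by move: e0; rewrite ltcE => /andP[].
have [s Ss xs] := h x _ e0'; exists s; split=> //; apply: he.
rewrite -ball_normE /= normE (complex_ge0E (ltW e0)) ltcR.
exact: xs.
Qed.

Lemma ortho_dense0 V (S : set V) (z : V) : dense S ->
  (forall s, S s -> rip s z = 0) -> z = 0.
Proof.
move=> dS h; apply: nrm_eq0; apply/eqP; rewrite -sqrf_eq0 eq_le sqr_ge0 andbT.
apply: (@le_addgt0 _ (nrm z)) => e e0; rewrite add0r.
have [s Ss zs] := dense_approx dS z e0.
rewrite -rip_diag -[X in X <= _]subr0 -(h s Ss) -ripBl.
by rewrite (le_trans (rip_le _ _))// mulrC ler_wpM2l ?nrm_ge0// ltW.
Qed.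

Lemma lspan_sub V (S : set V) : S `<=` lspan S.
Proof.
move=> x Sx; exists 1%N, (fun=> 1), (fun=> x); split=> //.
by rewrite big_ord1 scale1r.
Qed.

Lemma ortho_lspan0 V (S : set V) (z : V) : dense (lspan S) ->
  (forall s, S s -> ip s z = 0) -> z = 0.
Proof.
move=> dS h; apply: (ortho_dense0 dS) => _ [n [c [v [Sv ->]]]].
by rewrite /rip ip_suml big1// => i _; rewrite ipZl h// mulr0.
Qed.

(* A minimizing sequence of |v|^2 - 2 Re f(v) over S is Cauchy by the
   parallelogram identity. *)
Lemma riesz_subspace V (S : set V) (f : V -> R) (c : R) :
  S 0 -> (forall (a : R) x y, S x -> S y -> S (a%:C%C *: x + y)) ->
  (forall (a : R) x y, f (a%:C%C *: x + y) = a * f x + f y) ->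
  (forall x, S x -> f x <= c * nrm x) ->
  exists v, (forall e : R, 0 < e -> exists2 s, S s & nrm (v - s) < e) /\
    forall x, S x -> rip v x = f x.
Proof.
move=> S0 SD fD fc.
pose phi (x : V) : R := nrm x ^+ 2 - 2 * f x.
pose E := [set - phi x | x in S].
have ubE : ubound E (c ^+ 2).
  move=> _ [x Sx <-]; have := fc x Sx; have := sqr_ge0 (nrm x - c); rewrite /phi; lra.
have supE : has_sup E by split; [exists (- phi 0), 0|exists (c ^+ 2)].
pose m := - sup E.
have mle x : S x -> m <= phi x.
  by move=> Sx; rewrite /m lerNl; apply: ub_le_sup; [case: supE|exists x].
have mapx (e : R) : 0 < e -> exists2 x, S x & phi x < m + e.
  move=> e0; have [_ [x Sx <-] hx] := sup_adherent e0 supE.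
  by exists x => //; move: hx; rewrite /m; lra.
have f0 : f 0 = 0 by have := fD 1 0 0; rewrite scaler0 addr0 mul1r; lra.
have fZ (a : R) x : f (a%:C%C *: x) = a * f x.
  by have := fD a x 0; rewrite !addr0 f0 addr0.
have para x y : S x -> S y -> nrm (x - y) ^+ 2 <= 2 * (phi x - m) + 2 * (phi y - m).
  move=> Sx Sy.
  have Sz : S ((2^-1)%:C%C *: x + (2^-1)%:C%C *: y).
    by apply: (SD) => //; rewrite -[X in S X]addr0; apply: SD.
  have := mle _ Sz; rewrite /phi nrm_sqrB nrm_sqrD fD fZ ripZr ripZl !nrmZr !exprMn.
  by rewrite real_normK ?num_real//; lra.
have [u hu] : {u : nat -> V & forall n, S (u n) /\ phi (u n) < m + n.+1%:R^-1}.
  have h (n : nat) : {x | S x /\ phi x < m + n.+1%:R^-1}.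
    have [|x Sx hx] := @cid2 _ _ _ (mapx (n.+1%:R^-1) _); first by rewrite invr_gt0 ltr0n.
    by exists x.
  by exists (fun n => sval (h n)) => n; exact: (svalP (h n)).
have [|v hv] := cauchy_limit (u := u).
  (* The tolerance is e^2 / 4, since [para] bounds the squared distance by twice the sum of two
     defects. *)
  move=> e e0; have [N hN] := inv_succ_lt (divr_gt0 (exprn_gt0 2 e0) (ltr0Sn _ 3)).
  exists N => p q Np Nq; rewrite -ltr_sqr ?nnegrE ?nrm_ge0 ?(ltW e0)//.
  have [Sp hp] := hu p; have [Sq hq] := hu q.
  have := lt_trans hp (ler_ltD (lexx m) (hN _ Np)).
  have := lt_trans hq (ler_ltD (lexx m) (hN _ Nq)).
  move: (para _ _ Sp Sq); clear; move: (phi _) (phi _) (nrm _ ^+ 2) => a b d; lra.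
have dv (e : R) : 0 < e -> exists n, nrm (u n - v) < e /\ n.+1%:R^-1 < e.
  move=> e0; have [N1 h1] := hv e e0; have [N2 h2] := inv_succ_lt e0.
  exists (maxn N1 N2); split; [exact/h1/leq_maxl|exact/h2/leq_maxr].
exists v; split=> [e e0|x Sx].
  by have [n [hn _]] := dv e e0; exists (u n); [case: (hu n)|rewrite nrmB].
(* First variation: m <= phi (t x + u n) in the limit gives a quadratic in t with constant term 0,
   so its discriminant forces the linear coefficient to vanish. *)
have key (t : R) : 0 <= 0 + 2 * t * (rip v x - f x) + t ^+ 2 * nrm x ^+ 2.
  apply: (@le_addgt0 _ (1 + `|2 * t| * nrm x)) => e e0.
  have [n [hn1 hn2]] := dv e e0; have [Sn hn] := hu n.
  have St : S (t%:C%C *: x + u n) by exact: SD.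
  have := mle _ St; rewrite /phi fD nrm_sqrD nrmZr ripZl exprMn real_normK ?num_real//.
  rewrite /phi in hn.
  have h1 : 2 * t * (rip x (u n) - rip v x) <= `|2 * t| * nrm x * e.
    rewrite (ripC v) -ripBr (le_trans (ler_norm _))// normrM -mulrA ler_wpM2l//.
    rewrite ler_norml; apply/andP; split.
      rewrite lerNl -ripNr opprB (le_trans (rip_le _ _))// ler_wpM2l ?nrm_ge0//.
      by rewrite nrmB ltW.
    by rewrite (le_trans (rip_le _ _))// ler_wpM2l ?nrm_ge0// ltW.
  have hn' := lt_trans hn (ler_ltD (lexx m) hn2).
  have -> : (1 + `|2 * t| * nrm x) * e = e + `|2 * t| * nrm x * e by ring.
  move: h1 hn'.
  move: (_ * nrm x * e) (nrm x ^+ 2) (nrm (u n) ^+ 2) (f (u n)) (f x) (rip x _) (rip v x).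
  clear; move=> a b d f1 f2 r1 r2 ? ? ?. lra.
have := discr_le (sqr_ge0 _) key; rewrite mul0r => h0.
apply/eqP; rewrite -subr_eq0 -sqrf_eq0; apply/eqP/le_anti.
by rewrite h0 sqr_ge0.
Qed.

End Topology.

Section EsumSeq.
Context {R : realType} {I : choiceType}.
Implicit Types (S : set I) (a : I -> R).

Lemma esum_le_seq S a (M : \bar R) :
  (forall s : seq I, uniq s -> (forall i, i \in s -> S i) ->
    ((\sum_(i <- s) a i)%:E <= M)%E) ->
  (\esum_(i in S) (a i)%:E <= M)%E.
Proof.
move=> h; apply: ge_ereal_sup => _ [F [finF FS] <-].
rewrite fsbig_finite//= sumEFin; apply: h; first exact: fset_uniq.
by move=> i; rewrite in_fset_set// inE => /FS.
Qed.

Lemma seq_le_esum S (a : I -> \bar R) (s : seq I) : uniq s ->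
  (forall i, i \in s -> S i) ->
  (\sum_(i <- s) a i <= \esum_(i in S) a i)%E.
Proof.
move=> us sS; apply: esum_ge; exists [set` s].
  by split; [exact: finite_seq|move=> i /=; exact: sS].
by rewrite -fsbig_seq.
Qed.

End EsumSeq.

(** * Adjoints and bounded operators *)

Section Adjoint.
Context {R : realType}.
Implicit Types V W : hilbertType R.

Lemma rip_ipE V (v : V) (f : V -> R[i]) : (forall a x, f (a *: x) = a * f x) ->
  (forall x, rip v x = complex.Re (f x)) -> forall x, ip v x = f x.
Proof.
move=> fZ h x; apply: complex_eqP; first exact: h.
by rewrite -ipZ -fZ; exact: h.
Qed.

(** B y is the Riesz vector of x |-> <y, A x>. Its bound comes from |B y|^2 = Re <y, A (B y)> <= c
    |y| |B y|. *)
Lemma adjoint_exists V W (A : V -> W) : bounded_op A ->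
  exists B : W -> V, bounded_op B /\ forall x y, ip y (A x) = ip (B y) x.
Proof.
move=> /bounded_opP [lA [c c0 hc]].
have ex y : exists v, forall x, ip v x = ip y (A x).
  have [||||v [_ hv]] := @riesz_subspace _ _ setT (fun x => rip y (A x)) (nrm y * c) => //.
  - by move=> a x z; rewrite linD// linZ// ripDr ripZr.
  - by move=> x _; rewrite (le_trans (rip_le _ _))// -mulrA ler_wpM2l ?nrm_ge0.
  exists v; apply: rip_ipE => [a x|x]; first by rewrite linZ// ipZ.
  exact: hv.
have [B hB] := choice ex; exists B; split; last by move=> x y; rewrite hB.
apply/bounded_opP; split.
  move=> a x y; apply: ip_ext => z; rewrite ripC [in RHS]ripC /rip hB.
  by rewrite ipDl ipZl -!hB -ipZl -ipDl.
exists c => // y; have [->|y0] := eqVneq (nrm (B y)) 0.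
  by rewrite mulr_ge0 ?nrm_ge0.
have By0 : 0 < nrm (B y) by rewrite lt0r y0 nrm_ge0.
rewrite -(ler_pM2r By0) -expr2 -rip_diag /rip hB.
by rewrite (le_trans (rip_le _ _))// mulrAC mulrC ler_wpM2r ?nrm_ge0.
Qed.

Lemma adjoint_bounded V W (A : V -> W) : bounded_op A -> bounded_op (adjoint A).
Proof. by move=> /adjoint_exists /getPex []. Qed.

Lemma adjointE V W (A : V -> W) : bounded_op A ->
  forall x y, ip y (A x) = ip (adjoint A y) x.
Proof. by move=> /adjoint_exists /getPex []. Qed.

Lemma adjointEr V W (A : V -> W) : bounded_op A ->
  forall x y, ip (A x) y = ip x (adjoint A y).
Proof. by move=> bA x y; rewrite ip_conj [RHS]ip_conj adjointE. Qed.

Lemma adjoint_uniq V W (A : V -> W) (B : W -> V) : bounded_op A ->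
  (forall x y, ip y (A x) = ip (B y) x) -> adjoint A = B.
Proof.
move=> bA hB; apply/funext => y; apply: ip_ext => z.
by rewrite ripC [RHS]ripC /rip -adjointE// hB.
Qed.

Lemma isometry_bounded V W (A : V -> W) : isometry_op A -> bounded_op A.
Proof. by case=> lA hA; split=> //; exists 1 => x; rewrite mul1r hA. Qed.

Lemma isometry_nrm V W (A : V -> W) x : isometry_op A -> nrm (A x) = nrm x.
Proof. by case=> _ hA; rewrite /nrm hA. Qed.

Lemma bounded_comp V W (X : hilbertType R) (A : V -> W) (B : W -> X) :
  bounded_op A -> bounded_op B -> bounded_op (B \o A).
Proof.
move=> /bounded_opP [lA [c c0 hc]] /bounded_opP [lB [d d0 hd]].
apply/bounded_opP; split; first by move=> a x y /=; rewrite lA lB.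
exists (d * c) => [|x /=]; first exact: mulr_ge0.
by rewrite (le_trans (hd _))// -mulrA ler_wpM2l.
Qed.

Lemma bounded_lcomb V W (a : R[i]) (A B : V -> W) :
  bounded_op A -> bounded_op B -> bounded_op (a *: A + B).
Proof.
move=> /bounded_opP [lA [c c0 hc]] /bounded_opP [lB [d d0 hd]].
have E x : (a *: A + B) x = a *: A x + B x by [].
apply/bounded_opP; split.
  by move=> b x y; rewrite !E lA lB !scalerDr !scalerA mulrC addrACA.
exists (Num.sqrt (sqn a) * c + d) => [|x].
  by rewrite addr_ge0// mulr_ge0 ?sqrtr_ge0.
rewrite E (le_trans (nrmD_le _ _))// mulrDl lerD//.
rewrite -mulrA -ler_sqr ?nnegrE ?nrm_ge0 ?mulr_ge0 ?sqrtr_ge0 ?nrm_ge0//.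
rewrite nrmZ exprMn sqr_sqrtr ?sqn_ge0// ler_wpM2l ?sqn_ge0//.
by rewrite ler_sqr ?nnegrE ?mulr_ge0 ?nrm_ge0.
Qed.

Lemma bounded0 V W : bounded_op ((fun=> 0) : V -> W).
Proof.
split; first by move=> a x y; rewrite scaler0 addr0.
by exists 0 => x; rewrite mul0r normr0.
Qed.
Lemma bounded_add V W (A B : V -> W) : bounded_op A -> bounded_op B -> bounded_op (A + B).
Proof. by move=> bA bB; rewrite -[A]scale1r; exact: bounded_lcomb. Qed.
Lemma bounded_scale V W a (A : V -> W) : bounded_op A -> bounded_op (a *: A).
Proof.
move=> bA; rewrite -[_ *: A]addr0; apply: bounded_lcomb => //; exact: (bounded0 V W).
Qed.
Lemma bounded_opp V W (A : V -> W) : bounded_op A -> bounded_op (- A).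
Proof. by move=> bA; rewrite -scaleN1r; exact: bounded_scale. Qed.

(** For every w the vector A^* w - B^* w is orthogonal to S, hence zero; passing to adjoints
    replaces a continuity argument. *)
Lemma bounded_eq V W (A B : V -> W) (S : set V) : bounded_op A -> bounded_op B ->
  dense (lspan S) -> (forall x, S x -> A x = B x) -> A = B.
Proof.
move=> bA bB dS h; apply/funext => x; apply/subr0_eq.
apply: (@ip_ext _ _ _ 0) => w; rewrite {2}/rip ip0r ripBr.
suff : adjoint A w - adjoint B w = 0.
  by move=> e; rewrite /rip -ReB !adjointE// -ipBl e ip0l.
apply: (ortho_lspan0 dS) => s Ss.
by rewrite ipB -!adjointEr// h// subrr.
Qed.

End Adjoint.

(** * Orthonormal bases, Bessel and Parseval *)

Section Basis.
Context {R : realType} {V : hilbertType R}.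
Implicit Types (x y z : V) (S : set V).

Lemma lspan_comb S (a : R[i]) x y : lspan S x -> lspan S y -> lspan S (a *: x + y).
Proof.
move=> [n [c [v [Sv ->]]]] [m [d [w [Sw ->]]]]; exists (n + m)%N.
exists (fun i => match fintype.split i with inl j => a * c j | inr j => d j end).
exists (fun i => match fintype.split i with inl j => v j | inr j => w j end); split.
  by move=> i; case: (fintype.split i).
rewrite big_split_ord /= scaler_sumr; congr (_ + _); apply: eq_bigr => i _.
  by rewrite -[lshift _ _]/(unsplit (inl _)) unsplitK scalerA.
by rewrite -[rshift _ _]/(unsplit (inr _)) unsplitK.
Qed.

(** Zorn gives a maximal orthonormal set. If its span missed a neighbourhood of x, the normalized
    difference of x and its projection could be added. *)
Lemma onbasis_exists : exists E : set V, onbasis E.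
Proof.
pose ON (E : set V) := forall x y, E x -> E y -> ip x y = (x == y)%:R.
have [|E [onE maxE]] := @Zorn_bigcup _ ON.
  move=> F FON tF x y [X FX Xx] [Y FY Yy].
  by have [XY|YX] := tF X Y FX FY; [apply: (FON Y)|apply: (FON X)] => //; [exact: XY|exact: YX].
exists E; split=> //; apply: approx_dense => x e e0.
have S0 : lspan E 0 by exists 0%N, (fun=> 0), (fun=> 0); split; [case|rewrite big_ord0].
(* With f = Re <x, .> on the span of E, the Riesz vector v is the orthogonal projection of x to the
   closed span. *)
have [|y _|v [hv1 hv2]] := @riesz_subspace _ _ (lspan E) (rip x) (nrm x) S0
  (fun a y z => @lspan_comb E _ y z).
- by move=> a y z; rewrite ripDr ripZr.
- exact: rip_le.
have orth y : E y -> ip y (x - v) = 0.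
  move=> Ey; have Sy := lspan_sub Ey.
  apply: (@rip0_ip0 _ _ (lspan E)) => // [a z Sz|z Sz].
    by rewrite -[_ *: z]addr0; exact: lspan_comb.
  by rewrite ripBr ripC -hv2// ripC subrr.
have [xv|xv] := eqVneq (nrm (x - v)) 0.
  by rewrite (subr0_eq (nrm_eq0 xv)); exact: hv1.
exfalso; pose z := (nrm (x - v))^-1%:C%C *: (x - v).
have zz : ip z z = 1.
  rewrite ip_diag nrmZr ger0_norm ?invr_ge0 ?nrm_ge0// mulVf// expr1n; exact: rmorph1.
have zE y : E y -> ip y z = 0 by move=> Ey; rewrite ipZ orth ?mulr0.
have nEz : ~ E z by move=> /zE; rewrite zz => /eqP; rewrite oner_eq0.
apply: (maxE (E `|` [set z])).
  by split=> [y Ey|h]; [left|apply/nEz/h; right].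
move=> a b [Ea|->] [Eb|->]; first exact: onE.
- by rewrite zE//; case: eqP => // az; case: nEz; rewrite -az.
- by rewrite ip_conj zE// rmorph0; case: eqP => // az; case: nEz; rewrite az.
- by rewrite zz eqxx.
Qed.

Definition hbasis : set V := get (@onbasis R V).

Lemma hbasisP : onbasis hbasis.
Proof. exact: getPex onbasis_exists. Qed.

(** Weaker than orthonormality, so that it also covers images of orthonormal families under adjoints
    of contractions. *)
Definition bessel {I : Type} (s : seq I) (phi : I -> V) :=
  forall v, \sum_(i <- s) sqn (ip (phi i) v) <= nrm v ^+ 2.

Lemma on_pythagoras {I : eqType} (s : seq I) (phi : I -> V) v : uniq s ->
  {in s &, forall i j, ip (phi i) (phi j) = (i == j)%:R} ->
  let w := \sum_(i <- s) ip (phi i) v *: phi i in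
  {in s, forall i, ip (phi i) (v - w) = 0} /\
  nrm (v - w) ^+ 2 = nrm v ^+ 2 - \sum_(i <- s) sqn (ip (phi i) v).
Proof.
move=> us hphi w.
have hw i : i \in s -> ip (phi i) w = ip (phi i) v.
  move=> si; rewrite ip_sumr (bigD1_seq i)//= ipZ hphi// eqxx mulr1.
  rewrite big_seq_cond big1 ?addr0// => j /andP[sj ji].
  by rewrite ipZ hphi// eq_sym (negbTE ji) mulr0.
have hvw : {in s, forall i, ip (phi i) (v - w) = 0}.
  by move=> i si; rewrite ipB hw// subrr.
split=> //; have e0 : rip w (v - w) = 0.
  by rewrite /rip ip_suml big_seq big1// => i si; rewrite ipZl hvw// mulr0.
have e1 : rip v w = \sum_(i <- s) sqn (ip (phi i) v).
  rewrite /rip ip_sumr Re_sum; apply: eq_bigr => i _.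
  by rewrite ipZ mulrC (ip_conj (phi i) v) -sqnE.
by rewrite -rip_diag ripBl e0 subr0 ripBr e1 rip_diag.
Qed.

Lemma on_bessel {I : eqType} (s : seq I) (phi : I -> V) : uniq s ->
  {in s &, forall i j, ip (phi i) (phi j) = (i == j)%:R} -> bessel s phi.
Proof.
move=> us hs v; have [_ h] := on_pythagoras v us hs.
by rewrite -subr_ge0 -h sqr_ge0.
Qed.

(** Repeated vectors are merged by adding their coefficients, because [on_pythagoras] works with
    duplicate-free lists. *)
Lemma lspan_seq S x : lspan S x -> exists s : seq V,
  [/\ uniq s, forall b, b \in s -> S b &
      exists c : V -> R[i], x = \sum_(b <- s) c b *: b].
Proof.
move=> [n [c [v [Sv ->]]]]; exists (undup [seq v i | i <- enum 'I_n]); split.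
- exact: undup_uniq.
- by move=> b; rewrite mem_undup => /mapP[i _ ->].
exists (fun b => \sum_(i < n | v i == b) c i).
under [RHS]eq_bigr do rewrite scaler_suml.
rewrite [RHS](exchange_big_dep predT)//=; apply: eq_bigr => i _.
rewrite -big_filter (@eq_filter _ _ (pred1 (v i))) => [|b]; last by rewrite /= eq_sym.
rewrite filter_pred1_uniq ?undup_uniq ?big_seq1// mem_undup.
by apply/mapP; exists i => //; rewrite mem_enum.
Qed.

(** Approximate v by some g in the span. The projection w of v to the span of the finitely many
    basis vectors in g is at least as close to v as g, and |v|^2 - |v - w|^2 is a finite partial sum
    of the series. *)
Lemma parseval_le v : ((nrm v ^+ 2)%:E <= \esum_(b in hbasis) (sqn (ip b v))%:E)%E.
Proof.
have [onb db] := hbasisP.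
apply/lee_addgt0Pr => e e0.
have se0 : 0 < Num.sqrt e by rewrite sqrtr_gt0.
have [g lg vg] := dense_approx db v se0.
have [s [us sb [c gE]]] := lspan_seq lg.
have ons : {in s &, forall i j, ip (id i) (id j) = (i == j)%:R}.
  by move=> i j /sb bi /sb bj; exact: onb.
have [ho1 ho2] := on_pythagoras v us ons.
set w := \sum_(i <- s) _ in ho1 ho2.
have hvw : nrm (v - w) ^+ 2 <= e.
  (* Both w and g lie in the span of [s], to which v - w is orthogonal. *)
  have hwg : rip (v - w) (v - w) = rip (v - w) (v - g).
    rewrite !ripBr; congr (_ - _); rewrite /w gE /rip !ip_sumr.
    congr complex.Re; apply: eq_big_seq => i si.
    by rewrite !ipZ [X in _ * X = _]ip_conj [X in _ = _ * X]ip_conj ho1// rmorph0 !mulr0.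
  have h1 : nrm (v - w) ^+ 2 <= nrm (v - w) * nrm (v - g).
    by rewrite -rip_diag hwg rip_le.
  have : nrm (v - w) <= nrm (v - g).
    have [->|n0] := eqVneq (nrm (v - w)) 0; first exact: nrm_ge0.
    have n1 : 0 < nrm (v - w) by rewrite lt0r n0 nrm_ge0.
    by move: h1; rewrite expr2 ler_pM2l.
  move=> h2; rewrite -(sqr_sqrtr (ltW e0)) ler_sqr ?nnegrE ?nrm_ge0 ?sqrtr_ge0//.
  exact/(le_trans h2)/ltW.
have -> : nrm v ^+ 2 = nrm (v - w) ^+ 2 + \sum_(i <- s) sqn (ip i v).
  by rewrite ho2 subrK.
rewrite EFinD addeC leeD ?lee_fin//.
by rewrite -sumEFin; exact: seq_le_esum.
Qed.

End Basis.
Arguments hbasis {R} V.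

(** * Positive operators and the trace *)

Section Positive.
Context {R : realType}.
Implicit Types V W : hilbertType R.

Definition qf V (A : V -> V) (x : V) : R := rip x (A x).

Lemma pos_bdd V (A : V -> V) : positive_op A -> bounded_op A.
Proof. by case. Qed.
Lemma pos_lin V (A : V -> V) : positive_op A -> linear A.
Proof. by case=> /bounded_op_lin. Qed.
Lemma qf_ge0 V (A : V -> V) x : positive_op A -> 0 <= qf A x.
Proof. by case=> _ /(_ x) /Re_ge0. Qed.

(** The defect [s] of self-adjointness is a sesquilinear form that vanishes on the diagonal, a
    positive form being real there; evaluating it at x + y and at i x + y kills it. *)
Lemma pos_sa V (A : V -> V) : positive_op A -> forall x y, ip y (A x) = ip (A y) x.
Proof.
move=> pA x y; have lA := pos_lin pA.
pose s u v := ip u (A v) - ip (A u) v.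
have sD u v w : s u (v + w) = s u v + s u w by rewrite /s linD// !ipD; ring.
have sDl u v w : s (u + v) w = s u w + s v w by rewrite /s linD// !ipDl; ring.
have sZ a u v : s u (a *: v) = a * s u v by rewrite /s linZ// !ipZ; ring.
have sZl a u v : s (a *: u) v = a^* * s u v by rewrite /s linZ// !ipZl; ring.
have s0 u : s u u = 0.
  apply/eqP; rewrite subr_eq0; apply/eqP; rewrite [RHS]ip_conj.
  by case: pA => _ /(_ u) /complex_ge0E ->; rewrite conjCC.
have h1 : s y x + s x y = 0.
  by have := s0 (x + y); rewrite sD !sDl !s0 add0r addr0 addrC.
have h2 : s y x - s x y = 0.
  have := s0 ('i%C *: x + y).
  have ci : ('i%C : R[i])^* = - 'i%C by congr Complex; rewrite oppr0.
  rewrite sD !sDl !sZ !sZl !s0 ci !mulr0 add0r addr0 mulNr -mulrBr => /eqP.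
  rewrite mulf_eq0 subr_eq0 => /orP[/eqP[] /eqP|/eqP ->]; last by rewrite subrr.
  by rewrite oner_eq0.
apply/eqP; rewrite -subr_eq0 -/(s y x); apply/eqP.
have : 2 * s y x = (s y x + s x y) + (s y x - s x y) by ring.
by rewrite h1 h2 addr0 => /eqP; rewrite mulf_eq0 pnatr_eq0 => /eqP.
Qed.

Lemma positiveI V (A : V -> V) : bounded_op A ->
  (forall x y, ip y (A x) = ip (A y) x) -> (forall x, 0 <= qf A x) -> positive_op A.
Proof.
move=> bA sA qA; split=> // x; have := qA x; rewrite /qf /rip.
have : (ip x (A x))^* = ip x (A x) by rewrite -ip_conj -sA.
case: (ip x (A x)) => a b [/eqP]; rewrite eq_sym -addr_eq0 -mulr2n mulrn_eq0 /= => /eqP ->.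
by rewrite ler0c.
Qed.

Lemma pos_adjoint V (A : V -> V) : positive_op A -> adjoint A = A.
Proof. by move=> pA; apply: adjoint_uniq (pos_bdd pA) _; exact: pos_sa. Qed.

Lemma pos_rip V (A : V -> V) x y : positive_op A -> rip y (A x) = rip (A y) x.
Proof. by move=> pA; rewrite /rip pos_sa. Qed.

Lemma pos_CS V (A : V -> V) x y : positive_op A ->
  sqn (ip x (A y)) <= qf A x * qf A y.
Proof.
move=> pA; have lA := pos_lin pA.
have CSr u v : rip u (A v) ^+ 2 <= qf A u * qf A v.
  apply: discr_le; first exact: qf_ge0.
  move=> t; suff <- : qf A (u + t%:C%C *: v) =
      qf A u + 2 * t * rip u (A v) + t ^+ 2 * qf A v by exact: qf_ge0.
  rewrite /qf (linD lA) (linZ lA) !ripDr !ripDl !ripZr !ripZl.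
  by rewrite (pos_rip u v pA) (ripC _ u); ring.
(* Multiplying y by the conjugate of z makes the inner product real, equal to |z|^2; the real
   inequality then carries a spare factor |z|^2. *)
set z := ip x (A y).
have := CSr x (z^* *: y); rewrite /qf (linZ lA) /rip !ipZ !ipZl -/z conjCM_sqn /=.
rewrite conjCK mulrA conjCM_sqn ReZ -/(rip y (A y)) -/(qf A y).
rewrite -/(rip x (A x)) -/(qf A x) => h.
have [z0|z0] := eqVneq (sqn z) 0.
  by rewrite z0 mulr_ge0// qf_ge0.
have z1 : 0 < sqn z by rewrite lt0r z0 sqn_ge0.
by rewrite -(ler_pM2l z1) -expr2 (le_trans h)// mulrCA.
Qed.

(** Cauchy-Schwarz for the form, applied to A x and x, bounds |A x|^4 by 0. *)
Lemma pos_q0 V (A : V -> V) x : positive_op A -> qf A x = 0 -> A x = 0.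
Proof.
move=> pA q0; apply: nrm_eq0; apply/eqP; rewrite -sqrf_eq0 eq_le sqr_ge0 andbT.
have := pos_CS (A x) x pA; rewrite q0 mulr0 ip_diag /sqn /= expr0n addr0 => h.
have : (nrm (A x) ^+ 2) ^+ 2 == 0 by rewrite eq_le h sqr_ge0.
by rewrite sqrf_eq0 => /eqP ->.
Qed.


Lemma qfD V (A B : V -> V) x : qf (A + B) x = qf A x + qf B x.
Proof. by rewrite /qf -ripDr. Qed.
Lemma qfB V (A B : V -> V) x : qf (A - B) x = qf A x - qf B x.
Proof. by rewrite /qf -ripBr. Qed.
Lemma qfZ V (a : R) (A : V -> V) x : qf (a%:C%C *: A) x = a * qf A x.
Proof. by rewrite /qf -ripZr. Qed.

Lemma pos_add V (A B : V -> V) : positive_op A -> positive_op B -> positive_op (A + B).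
Proof.
move=> pA pB; apply: positiveI.
- by apply: bounded_add; exact: pos_bdd.
- by move=> x y; rewrite !(_ : forall z, (A + B) z = A z + B z)// ipD ipDl !pos_sa.
- by move=> x; rewrite qfD addr_ge0//; exact: qf_ge0.
Qed.

Lemma pos_scale V (a : R) (A : V -> V) : 0 <= a -> positive_op A -> positive_op (a%:C%C *: A).
Proof.
move=> a0 pA; apply: positiveI.
- by apply: bounded_scale; exact: pos_bdd.
- move=> x y; rewrite !(_ : forall z, (a%:C%C *: A) z = a%:C%C *: A z)//.
  by rewrite ipZ ipZl conjCC pos_sa.
- by move=> x; rewrite qfZ mulr_ge0// qf_ge0.
Qed.

Lemma pos_zero V : positive_op ((fun=> 0) : V -> V).
Proof.
apply: positiveI; first exact: bounded0.
  by move=> x y; rewrite ip0l ip0r.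
by move=> x; rewrite /qf /rip ip0r.
Qed.

Lemma pos_sub V (A B : V -> V) : positive_op A -> positive_op B ->
  (forall x, qf B x <= qf A x) -> positive_op (A - B).
Proof.
move=> pA pB h; apply: positiveI.
- by apply: bounded_add; [exact: pos_bdd|exact/bounded_opp/pos_bdd].
- by move=> x y; rewrite !(_ : forall z, (A - B) z = A z - B z)// ipB ipBl !pos_sa.
- by move=> x; rewrite qfB subr_ge0.
Qed.

Lemma pos_conj V W (A : V -> W) (X : V -> V) : bounded_op A -> positive_op X ->
  positive_op (A \o X \o adjoint A).
Proof.
move=> bA pX; apply: positiveI.
- by apply: bounded_comp; [exact: adjoint_bounded|apply: bounded_comp => //; exact: pos_bdd].
- by move=> x y /=; rewrite (adjointE bA) (pos_sa pX) (adjointEr bA).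
- by move=> x; rewrite /qf /rip /= (adjointE bA); exact: (qf_ge0 (adjoint A x) pX).
Qed.
Lemma qf_conj V W (A : V -> W) (X : V -> V) x : bounded_op A ->
  qf (A \o X \o adjoint A) x = qf X (adjoint A x).
Proof. by move=> bA; rewrite /qf /rip /= (adjointE bA). Qed.

Lemma adjointK V W (A : V -> W) : bounded_op A -> adjoint (adjoint A) = A.
Proof.
by move=> bA; apply: adjoint_uniq => [|x y]; [exact: adjoint_bounded|rewrite adjointEr].
Qed.

Lemma pos_conj_adj V W (A : V -> W) (X : W -> W) : bounded_op A -> positive_op X ->
  positive_op (adjoint A \o X \o A).
Proof.
by move=> bA pX; rewrite -{2}(adjointK bA); apply: pos_conj => //; exact: adjoint_bounded.
Qed.
Lemma qf_conj_adj V W (A : V -> W) (X : W -> W) x : bounded_op A ->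
  qf (adjoint A \o X \o A) x = qf X (A x).
Proof. by move=> bA; rewrite /qf /rip /= (adjointEr bA). Qed.

Lemma CS_ip V (x y : V) : sqn (ip x y) <= nrm x ^+ 2 * nrm y ^+ 2.
Proof.
have [p0|p0] := eqVneq (sqn (ip x y)) 0.
  by rewrite p0 mulr_ge0 ?sqr_ge0.
have z1 : 0 < sqn (ip x y) by rewrite lt0r p0 sqn_ge0.
rewrite -(ler_pM2l z1) -expr2.
have := CS_rip (ip x y *: x) y; rewrite nrmZ /rip ipZl conjCM_sqn /=.
by rewrite -mulrA.
Qed.

Lemma pos_ketbra V (v : V) : positive_op (ketbra v v).
Proof.
apply: positiveI; rewrite /ketbra.
- apply/bounded_opP; split; first by move=> a x y; rewrite ipD ipZ scalerDl scalerA.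
  exists (nrm v ^+ 2) => [|x]; first exact: sqr_ge0.
  rewrite -ler_sqr ?nnegrE ?mulr_ge0 ?sqr_ge0 ?nrm_ge0// nrmZ exprMn.
  by rewrite [in leRHS]expr2 mulrAC ler_wpM2r ?sqr_ge0// CS_ip.
- by move=> x y; rewrite ipZ ipZl -ip_conj mulrC.
- by move=> x; rewrite /qf /rip ipZ (ip_conj v x) mulrC -sqnE; exact: sqn_ge0.
Qed.
Lemma qf_ketbra V (v x : V) : qf (ketbra v v) x = sqn (ip v x).
Proof. by rewrite /qf /ketbra /rip ipZ (ip_conj v x) mulrC -sqnE. Qed.

(* Cholesky: subtracting |Eb><Eb|/<b,Eb> leaves a positive form that kills b. *)
Lemma cholesky V (bs : seq V) (E : V -> V) : positive_op E ->
  exists (vs : seq V) (E' : V -> V), [/\ positive_op E',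
    forall x, qf E x = \sum_(v <- vs) sqn (ip v x) + qf E' x &
    forall b, b \in bs -> E' b = 0].
Proof.
move=> pE; elim: bs => [|b bs [vs [E' [pE' hE kE]]]].
  by exists [::], E; split=> // x; rewrite big_nil add0r.
have [q0|q0] := eqVneq (qf E' b) 0.
  exists vs, E'; split=> // c; rewrite in_cons => /orP[/eqP ->|/kE//].
  exact: pos_q0.
have q1 : 0 < qf E' b by rewrite lt0r q0 qf_ge0.
pose v := (Num.sqrt (qf E' b))^-1%:C%C *: E' b.
have qv x : sqn (ip v x) = (qf E' b)^-1 * sqn (ip b (E' x)).
  rewrite ipZl sqnM sqn_conj (pos_sa pE') {1}/sqn /= expr0n addr0.
  by rewrite exprVn sqr_sqrtr ?qf_ge0.
have kv x : ketbra v v x = ((qf E' b)^-1%:C%C * ip b (E' x)) *: E' b.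
  rewrite /ketbra ipZl conjCC scalerA (pos_sa pE') mulrAC -RealM.
  by rewrite -expr2 exprVn sqr_sqrtr ?qf_ge0.
have pE'' : positive_op (E' - ketbra v v).
  apply: pos_sub => //; first exact: pos_ketbra.
  by move=> x; rewrite qf_ketbra qv mulrC ler_pdivrMr// mulrC pos_CS.
exists (v :: vs), (E' - ketbra v v); split=> //.
  by move=> x; rewrite big_cons qfB qf_ketbra hE; ring.
move=> c; rewrite in_cons (_ : (E' - ketbra v v) c = E' c - ketbra v v c)// kv.
move=> /orP[/eqP ->|/kE ->]; last by rewrite ip0r mulr0 scale0r subr0.
have -> : ip b (E' b) = (qf E' b)%:C%C by case: pE' => _ /(_ b) /complex_ge0E.
by rewrite -RealM mulVf// scale1r subrr.
Qed.

Lemma pos_sub_ker V (E : V -> V) (x g : V) : positive_op E -> E g = 0 ->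
  qf E x = qf E (x - g).
Proof.
move=> pE Eg; rewrite /qf (linB (pos_lin pE)) Eg subr0 ripBl.
have -> : rip g (E x) = 0 by rewrite pos_rip// Eg /rip ip0l.
by rewrite subr0.
Qed.

Lemma trace_ge0 V (A : V -> V) : positive_op A -> (0 <= trace A)%E.
Proof. by move=> pA; apply: esum_ge0 => x _; rewrite lee_fin; exact: qf_ge0. Qed.

(* Take g i in the span of the basis close to phi i, and use Cholesky to kill the
   g i: what is left of E is small at phi i, while the rank one pieces that were
   split off are handled by Parseval. *)
Lemma bessel_trace V (E : V -> V) {I : Type} (s : seq I) (phi : I -> V) :
  positive_op E -> bessel s phi -> ((\sum_(i <- s) qf E (phi i))%:E <= trace E)%E.
Proof.
move=> pE hs; have [onb db] := @hbasisP R V.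
have /bounded_opP [_ [c c0 hc]] := pos_bdd pE.
(* Each of the [size s] vectors costs at most c |phi i - g i|^2 <= c e^2. The [+ 1] below avoids a
   zero denominator. *)
suff h (e : R) : 0 < e ->
    ((\sum_(i <- s) qf E (phi i))%:E <= trace E + (c * (size s)%:R * e ^+ 2)%:E)%E.
  have K0 : 0 <= c * (size s)%:R by rewrite mulr_ge0.
  have K1 : 0 < c * (size s)%:R + 1 by rewrite ltr_wpDl.
  apply/lee_addgt0Pr => e e0.
  have := h (Num.sqrt (e / (c * (size s)%:R + 1))).
  rewrite sqrtr_gt0 divr_gt0// sqr_sqrtr ?divr_ge0 ?(ltW e0) ?(ltW K1)//.
  move=> /(_ isT) /le_trans; apply.
  rewrite leeD2l// lee_fin mulrA ler_pdivrMr// mulrC ler_wpM2l ?(ltW e0)//.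
  by rewrite lerDl.
move=> e0.
have ex i : exists g, lspan (hbasis V) g /\ nrm (phi i - g) < e.
  by have [g ? ?] := dense_approx db (phi i) e0; exists g.
have [g hg] := choice ex.
have ex2 i : exists t : seq V, [/\ uniq t, forall b, b \in t -> hbasis V b &
    exists d : V -> R[i], g i = \sum_(b <- t) d b *: b].
  by apply: lspan_seq; case: (hg i).
have [t ht] := choice ex2.
have [vs [E' [pE' hE kE]]] := cholesky (flatten [seq t i | i <- s]) pE.
(* [List.In] is used because the index type [I] carries no decidable equality. *)
have Eg i : List.In i s -> E' (g i) = 0.
  move=> si; have [_ _ [d ->]] := ht i.
  rewrite (lin_sum (pos_lin pE')) big_seq big1// => b bt.
  rewrite (linZ (pos_lin pE')) kE ?scaler0//.
  elim: (s) si => //= j s' IH [->|/IH h]; rewrite mem_cat ?bt// h orbT//.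
under eq_bigr do rewrite hE.
rewrite big_split /= EFinD leeD//.
  rewrite exchange_big /=.
  (* For each v split off, Bessel bounds the sum over phi by |v|^2 and Parseval bounds |v|^2 by the
     sum over the basis; exchanging the sums brings back the form of E on basis vectors. *)
  apply: (@le_trans _ _ (\sum_(v <- vs) \esum_(b in hbasis V) (sqn (ip b v))%:E)%E).
    rewrite -sumEFin; apply: lee_sum => v _; apply: le_trans (parseval_le v).
    rewrite lee_fin; apply: le_trans (hs v); apply: ler_sum => i _.
    by rewrite ip_conj sqn_conj.
  rewrite -esum_sum; last by move=> *; rewrite lee_fin sqn_ge0.
  apply: le_esum => b _; rewrite sumEFin lee_fin -/(rip b (E b)) -/(qf E b) hE.
  rewrite ler_wpDr ?qf_ge0//; apply: ler_sum => v _; rewrite ip_conj sqn_conj//.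
rewrite lee_fin.
have le1 i : List.In i s -> qf E' (phi i) <= c * e ^+ 2.
  move=> si; rewrite (pos_sub_ker (phi i) pE' (Eg i si)).
  set y := phi i - g i; have yl : nrm y < e by case: (hg i).
  apply: (@le_trans _ _ (qf E y)).
    by rewrite hE lerDr sumr_ge0// => v _; exact: sqn_ge0.
  rewrite (le_trans (rip_le _ _))// (le_trans (ler_wpM2l (nrm_ge0 _) (hc y)))//.
  rewrite mulrCA ler_wpM2l// -expr2 ler_sqr ?nnegrE ?nrm_ge0 ?(ltW e0)//.
  exact: ltW.
clear -le1; elim: s le1 => [|i s IH] le1; first by rewrite big_nil mulr0 mul0r.
rewrite big_cons /= -natr1 mulrDr mulr1 mulrDl addrC lerD//.
  by apply: IH => j sj; apply: le1; right.
by apply: le1; left.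
Qed.

End Positive.

(** * Trace, absolute value and trace norm *)

Section Trace.
Context {R : realType}.
Implicit Types V W : hilbertType R.

Lemma trace_le V (A B : V -> V) : (forall x, qf A x <= qf B x) -> (trace A <= trace B)%E.
Proof. by move=> h; apply: le_esum => x _; rewrite lee_fin; exact: h. Qed.

Lemma traceD V (A B : V -> V) : positive_op A -> positive_op B ->
  trace (A + B) = (trace A + trace B)%E.
Proof.
move=> pA pB; rewrite /trace -esumD; first last.
- by move=> x _; rewrite lee_fin; exact: qf_ge0.
- by move=> x _; rewrite lee_fin; exact: qf_ge0.
by apply: eq_esum => x _; rewrite -EFinD; congr EFin; exact: qfD.
Qed.

(** The vectors A^* b satisfy Bessel's inequality, as the sum of the |<b, A v>|^2 is at most |A v|^2
    <= |v|^2. *)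
Lemma trace_contraction V W (A : V -> W) (E : V -> V) : bounded_op A ->
  (forall x, nrm (A x) <= nrm x) -> positive_op E ->
  (trace (A \o E \o adjoint A) <= trace E)%E.
Proof.
move=> bA cA pE; have [onb _] := @hbasisP R W.
apply: esum_le_seq => s us sb.
have hb : bessel s (adjoint A).
  move=> v; under eq_bigr do rewrite -adjointE//.
  have := @on_bessel _ _ _ s id us _ (A v) => /(_ _)/le_trans; apply.
    by move=> i j /sb ? /sb ?; exact: onb.
  by rewrite ler_sqr ?nnegrE ?nrm_ge0.
apply: le_trans (bessel_trace pE hb); rewrite lee_fin le_eqVlt; apply/orP; left.
by apply/eqP/eq_bigr => b _; exact: qf_conj.
Qed.

Lemma isometry_ip V W (A : V -> W) x y : isometry_op A -> ip (A x) (A y) = ip x y.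
Proof.
move=> iA; have lA : linear A by case: iA.
have h u v : rip (A u) (A v) = rip u v.
  have := isometry_nrm (u + v) iA.
  move/(congr1 (fun t => t ^+ 2)); rewrite (linD lA) !nrm_sqrD !(isometry_nrm _ iA); lra.
apply: complex_eqP; first exact: h.
by rewrite -!ipZ -(linZ lA); exact: h.
Qed.

Lemma isometry_adjK V W (A : V -> W) x : isometry_op A -> adjoint A (A x) = x.
Proof.
move=> iA; apply: ip_ext => z; rewrite ripC /rip -adjointE; last exact: isometry_bounded.
by rewrite isometry_ip// -/(rip x z) ripC.
Qed.

(** For the reverse inequality, the images A b of basis vectors are orthonormal and A E A^* has the
    same form at A b as E at b. *)
Lemma trace_isometry V W (A : V -> W) (E : V -> V) : isometry_op A -> positive_op E ->
  trace (A \o E \o adjoint A) = trace E.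
Proof.
move=> iA pE; have bA := isometry_bounded iA.
apply/eqP; rewrite eq_le trace_contraction//=; last by move=> x; rewrite isometry_nrm.
have [onb _] := @hbasisP R V; apply: esum_le_seq => s us sb.
have hb : bessel s A.
  by apply: on_bessel => // i j /sb ? /sb ?; rewrite isometry_ip// onb.
apply: le_trans (bessel_trace (pos_conj bA pE) hb); rewrite lee_fin le_eqVlt.
apply/orP; left; apply/eqP/eq_bigr => b _; rewrite qf_conj// isometry_adjK//.
Qed.

(** A single unit vector is a Bessel family. *)
Lemma qf_le_trace V (E : V -> V) (t : R) x : positive_op E -> (trace E <= t%:E)%E ->
  qf E x <= t * nrm x ^+ 2.
Proof.
move=> pE tE; have [n0|n0] := eqVneq (nrm x) 0.
  by rewrite n0 expr0n mulr0 (nrm_eq0 n0) /qf /rip ip0l.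
have n1 : 0 < nrm x by rewrite lt0r n0 nrm_ge0.
pose y := (nrm x)^-1%:C%C *: x.
have ny : nrm y = 1 by rewrite nrmZr ger0_norm ?invr_ge0 ?nrm_ge0// mulVf.
have hy : bessel [:: tt] (fun=> y).
  by move=> v; rewrite big_seq1 (le_trans (CS_ip _ _))// ny expr1n mul1r.
have := le_trans (bessel_trace pE hy) tE; rewrite big_seq1 lee_fin.
rewrite /qf (linZ (pos_lin pE)) ripZr ripZl mulrA -invfM mulrC -expr2.
by rewrite ler_pdivrMr// exprn_gt0.
Qed.

(* If P <= E fails, the supremum l > 0 of <x,(P - E)x> over unit vectors has
   approximate eigenvectors x, and |Px| > |Ex| for them. *)
Lemma sqrt_monotone V (P E : V -> V) : positive_op P -> positive_op E ->
  (forall x, nrm (P x) = nrm (E x)) -> forall x, qf P x <= qf E x.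
Proof.
move=> pP pE PE x0; rewrite leNgt; apply/negP => x0lt.
have lP := pos_lin pP; have lE := pos_lin pE.
have /bounded_opP [_ [c c0 hc]] := pos_bdd pE.
pose D x := qf P x - qf E x.
have qZ (A : V -> V) (a : R) x : linear A -> qf A (a%:C%C *: x) = a ^+ 2 * qf A x.
  by move=> lA; rewrite /qf (linZ lA) ripZr ripZl; ring.
have D_le x : D x <= 2 * c * nrm x ^+ 2.
  have h1 : qf P x <= c * nrm x ^+ 2.
    rewrite (le_trans (rip_le _ _))// PE (le_trans (ler_wpM2l (nrm_ge0 _) (hc x)))//.
    by rewrite expr2 mulrCA.
  have := qf_ge0 x pE; have := mulr_ge0 c0 (sqr_ge0 (nrm x)); rewrite /D; lra.
pose S := [set D x | x in [set x : V | nrm x = 1]].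
have nx0 : 0 < nrm x0.
  rewrite lt0r nrm_ge0 andbT; apply/eqP => /nrm_eq0 e; move: x0lt.
  by rewrite e /qf /rip !ip0l ltxx.
have unit x : 0 < nrm x -> nrm ((nrm x)^-1%:C%C *: x) = 1.
  by move=> n0; rewrite nrmZr ger0_norm ?invr_ge0 ?nrm_ge0// mulVf// gt_eqF.
have DZ (a : R) x : D (a%:C%C *: x) = a ^+ 2 * D x by rewrite /D !qZ// mulrBr.
have supS : has_sup S.
  split.
    exists (D ((nrm x0)^-1%:C%C *: x0)), ((nrm x0)^-1%:C%C *: x0) => //.
    exact: unit.
  by exists (2 * c) => _ [x /= nx <-]; have := D_le x; rewrite nx expr1n mulr1.
pose l := sup S.
have Dl x : D x <= l * nrm x ^+ 2.
  have [n0|n0] := eqVneq (nrm x) 0.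
    by rewrite n0 expr0n mulr0 (nrm_eq0 n0) /D /qf /rip !ip0l subrr.
  have n1 : 0 < nrm x by rewrite lt0r n0 nrm_ge0.
  have : D ((nrm x)^-1%:C%C *: x) <= l.
    by apply: ub_le_sup; [case: supS|exists ((nrm x)^-1%:C%C *: x) => //; exact: unit].
  by rewrite DZ exprVn mulrC ler_pdivrMr// exprn_gt0.
have l0 : 0 < l.
  have := Dl x0; rewrite leNgt => h; rewrite ltNge; apply/negP => l0.
  have := Dl x0; have : l * nrm x0 ^+ 2 <= 0 by rewrite mulr_le0_ge0// sqr_ge0.
  rewrite /D; lra.
(* Q = l - (P - E) is positive by the choice of l, so Cauchy-Schwarz for Q turns a small <x, Q x>
   into a small |Q x|. *)
pose Q : V -> V := (l%:C%C *: (fun x => x) + E) - P.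
have QE x : Q x = l%:C%C *: x + E x - P x by [].
have bid : bounded_op (fun x : V => x).
  by split=> //; exists 1 => x; rewrite mul1r.
have bQ : bounded_op Q.
  by apply/bounded_add; [apply/bounded_lcomb => //; exact: pos_bdd|exact/bounded_opp/pos_bdd].
have qQ x : qf Q x = l * nrm x ^+ 2 - D x.
  by rewrite /qf QE ripBr ripDr ripZr rip_diag /D /qf; ring.
have pQ : positive_op Q.
  apply: positiveI => //; last by move=> x; rewrite qQ subr_ge0.
  by move=> x y; rewrite !QE ipB ipD ipBl ipDl ipZ ipZl conjCC (pos_sa pP) (pos_sa pE).
have /bounded_opP [_ [k k0 hk]] := bQ.
have c1 : 0 < 2 * c + l + 1 by lra.
(* With |Q x| <= d and |P x| = |E x|, expanding |l x + E x| <= |E x| + |Q x| gives l^2 <= |Q x| (2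
   |E x| + |Q x|) <= d (2 c + l), where d <= l is used; but d (2 c + l) = l^2 - d. *)
pose d := l ^+ 2 / (2 * c + l + 1).
have d0 : 0 < d by rewrite divr_gt0// exprn_gt0.
have dl : d <= l.
  by rewrite ler_pdivrMr// expr2 ler_pM2l//; lra.
have dc : d * (2 * c + l + 1) = l ^+ 2 by rewrite divfK// gt_eqF.
have k1 : 0 < k + 1 by lra.
have e0 : 0 < d ^+ 2 / (k + 1) by rewrite divr_gt0// exprn_gt0.
have [_ [x /= nx <-] hx] := sup_adherent e0 supS.
have qx : qf Q x < d ^+ 2 / (k + 1) by rewrite qQ nx expr1n mulr1; move: hx; rewrite -/l; lra.
have nQ : nrm (Q x) <= d.
  rewrite -ler_sqr ?nnegrE ?nrm_ge0 ?(ltW d0)//.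
  have [->|n0] := eqVneq (nrm (Q x) ^+ 2) 0; first exact: sqr_ge0.
  have n1 : 0 < nrm (Q x) ^+ 2 by rewrite lt0r n0 sqr_ge0.
  have := pos_CS (Q x) x pQ; rewrite ip_diag /sqn /= expr0n addr0 => h.
  have hq : qf Q (Q x) <= k * nrm (Q x) ^+ 2.
    rewrite (le_trans (rip_le _ _))// (le_trans (ler_wpM2l (nrm_ge0 _) (hk _)))//.
    by rewrite expr2 mulrCA.
  have : nrm (Q x) ^+ 2 <= k * qf Q x.
    rewrite -(ler_pM2r n1) -expr2 (le_trans h)// mulrAC.
    by rewrite ler_wpM2r ?qf_ge0.
  move/le_trans; apply; apply: (@le_trans _ _ ((k + 1) * qf Q x)).
    by rewrite ler_wpM2r ?qf_ge0// lerDl.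
  by rewrite mulrC -ler_pdivlMr// ltW.
have cx : nrm (E x) <= c by have := hc x; rewrite nx mulr1.
have tri : nrm (l%:C%C *: x + E x) <= nrm (E x) + nrm (Q x).
  rewrite -PE; suff -> : l%:C%C *: x + E x = P x + Q x by exact: nrmD_le.
  by rewrite QE [RHS]addrC subrK.
have : nrm (l%:C%C *: x + E x) ^+ 2 <= (nrm (E x) + nrm (Q x)) ^+ 2.
  by rewrite ler_sqr ?nnegrE ?addr_ge0 ?nrm_ge0.
rewrite nrm_sqrD nrmZr exprMn nx ripZl real_normK ?num_real// expr1n mulr1.
have := mulr_ge0 (ltW l0) (qf_ge0 x pE); rewrite /qf.
have := nrm_ge0 (Q x); have := nrm_ge0 (E x).
move: nQ cx dc dl d0 l0 c0; move: (nrm (Q x)) (nrm (E x)) (l * rip x (E x)).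
clear; move: (d) => d'; clear d; move: l => l'; clear.
move=> q a r nq ac dc dl d0 l0 c0 a0 q0 r0 h.
have h2 : l' ^+ 2 <= q * (2 * a + q) by lra.
have h3 : q * (2 * a + q) <= d' * (2 * c + l').
  by apply: ler_pM; lra.
have : d' * (2 * c + l' + 1) = d' * (2 * c + l') + d' by ring.
lra.
Qed.

(** [absop E] is whichever positive root the choice returns: E itself shows that one exists, and
    [sqrt_monotone] bounds them all by E. *)
Lemma traceclass_pos V (E : V -> V) : positive_op E -> (trace E < +oo)%E ->
  traceclass E /\ (tracenorm E <= trace E)%E.
Proof.
move=> pE tE; have aE : is_absop E (absop E).
  by apply: getPex; exists E; split=> //; rewrite pos_adjoint.
have le : (tracenorm E <= trace E)%E.
  case: aE; rewrite /tracenorm; move: (absop E) => P pP PE.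
  apply/trace_le/sqrt_monotone => // x.
  apply/eqP; rewrite -(@eqrXn2 _ 2) ?nrm_ge0// -!rip_diag.
  rewrite -(pos_rip (P x) x pP) -(pos_rip (E x) x pE).
  by have /(congr1 (fun f => f x)) /= -> := PE; rewrite pos_adjoint.
split=> //; split=> //; first exact: pos_bdd.
exact: le_lt_trans tE.
Qed.

(** With P = |E| one has |E x| = |P x|, and Cauchy-Schwarz for P gives |P x|^4 <= <P x, P P x> <x, P
    x>, each factor being bounded by the trace. Thus convergence in trace norm controls vectors. *)
Lemma nrm_le_tracenorm V (E : V -> V) (t : R) x : 0 <= t -> traceclass E ->
  (tracenorm E <= t%:E)%E -> nrm (E x) <= t * nrm x.
Proof.
move=> t0 [bE [pP PE] _]; rewrite /tracenorm; move: (absop E) pP PE => P pP PE tP.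
have -> : nrm (E x) = nrm (P x).
  apply/eqP; rewrite -(@eqrXn2 _ 2) ?nrm_ge0// -!rip_diag -(pos_rip (P x) x pP).
  have /(congr1 (fun f => f x)) /= -> := PE.
  by rewrite /rip adjointEr.
rewrite -ler_sqr ?nnegrE ?mulr_ge0 ?nrm_ge0//.
have [->|n0] := eqVneq (nrm (P x) ^+ 2) 0; first exact: sqr_ge0.
have n1 : 0 < nrm (P x) ^+ 2 by rewrite lt0r n0 sqr_ge0.
have := pos_CS (P x) x pP; rewrite ip_diag /sqn /= expr0n addr0 => h.
have h1 := qf_le_trace (P x) pP tP; have h2 := qf_le_trace x pP tP.
rewrite -(ler_pM2r n1) -expr2 (le_trans h)//.
rewrite (le_trans (ler_pM (qf_ge0 _ pP) (qf_ge0 _ pP) h1 h2))//.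
rewrite exprMn; set a := nrm x ^+ 2; set b := nrm (P x) ^+ 2.
by rewrite le_eqVlt; apply/orP; left; apply/eqP; ring.
Qed.

Lemma sum_fctE V W (J : Type) (s : seq J) (F : J -> V -> W) x :
  (\sum_(j <- s) F j) x = \sum_(j <- s) F j x.
Proof. by elim: s => [|j s IH]; rewrite ?big_nil// !big_cons -IH. Qed.

Lemma tsum_to_strong V (J : choiceType) (F : J -> V -> V) (S : V -> V) : tsum_to F S ->
  forall e : R, 0 < e -> exists A : {fset J}, forall B : {fset J}, fsubset A B ->
  forall x, nrm (S x - \sum_(j <- B) F j x) <= e * nrm x.
Proof.
move=> FS e e0; have [A hA] := FS e e0; exists A => B AB x.
have [tE nE] := hA B AB; rewrite -sum_fctE.
exact: nrm_le_tracenorm (ltW e0) tE (ltW nE).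
Qed.

Lemma tsum_to_uniq V (J : choiceType) (F : J -> V -> V) (S S' : V -> V) :
  tsum_to F S -> tsum_to F S' -> S = S'.
Proof.
move=> FS FS'; apply/funext => x; apply/subr0_eq/nrm_eq0/le_anti.
rewrite nrm_ge0 andbT; apply: (@le_addgt0 _ (2 * nrm x)) => e e0.
have [A hA] := tsum_to_strong FS e0; have [A' hA'] := tsum_to_strong FS' e0.
have h := hA _ (fsubsetUl A A') x; have h' := hA' _ (fsubsetUr A A') x.
rewrite add0r; set T := \sum_(j <- _) _ in h h'.
have -> : S x - S' x = (S x - T) + - (S' x - T) by rewrite opprB addrA subrK.
by rewrite (le_trans (nrmD_le _ _))// nrmN; lra.
Qed.

Lemma tsumE V (J : choiceType) (F : J -> V -> V) (S : V -> V) :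
  bounded_op S -> tsum_to F S -> tsum F = S.
Proof.
move=> bS FS; have [_ h] : [set S : V -> V | bounded_op S /\ tsum_to F S] (tsum F).
  by apply: getPex; exists S.
exact: tsum_to_uniq FS.
Qed.

End Trace.

Section EsumExtra.
Context {R : realType}.

Lemma esum_exchange (I J : choiceType) (A : set I) (B : set J) (a : I -> J -> \bar R) :
  (forall i j, (0 <= a i j)%E) ->
  \esum_(i in A) \esum_(j in B) a i j = \esum_(j in B) \esum_(i in A) a i j.
Proof.
move=> a0; rewrite !esum_esum//.
rewrite (@reindex_esum _ _ _ (B `*`` (fun=> A)) _ (fun k => (k.2, k.1)))//.
split=> [[x y] /= [? ?]//|[x y] [x' y'] _ _ /= [-> ->]//|[x y] [/= Ax By]].
by exists (y, x).
Qed.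

Lemma esumZ (I : choiceType) (A : set I) (c : R) (f : I -> \bar R) : 0 <= c ->
  (forall i, (0 <= f i)%E) ->
  \esum_(i in A) (c%:E * f i)%E = (c%:E * \esum_(i in A) f i)%E.
Proof.
move=> c0 f0; rewrite /esum -ereal_supZl//; last first.
  by apply/set0P; exists (\sum_(i \in set0) f i), set0 => //; exact: fsets_set0.
congr ereal_sup; apply/seteqP; split=> [_ [X hX <-]|_ [_ [X hX <-] <-]].
  by exists (\sum_(x \in X) f x); [exists X|rewrite ge0_mule_fsumr].
by exists X => //; rewrite ge0_mule_fsumr.
Qed.

End EsumExtra.

(** * Trace-summable series of positive operators *)

Section PositiveSeries.
Context {R : realType} {V : hilbertType R}.

Lemma traceZ (a : R) (A : V -> V) : 0 <= a -> positive_op A ->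
  trace (a%:C%C *: A) = (a%:E * trace A)%E.
Proof.
move=> a0 pA; rewrite /trace.
have -> : \esum_(x in get (@onbasis R V)) (complex.Re (ip x (A x)))%:E =
  \esum_(x in get (@onbasis R V)) (`|complex.Re (ip x (A x))|)%:E.
  by apply: eq_esum => x _; rewrite ger0_norm//; exact: qf_ge0.
rewrite -esumZ//; apply: eq_esum => x _; rewrite -EFinM; congr EFin.
by rewrite ger0_norm; [exact: qfZ|exact: qf_ge0].
Qed.

Lemma pos_sum (J : eqType) (s : seq J) (F : J -> V -> V) :
  (forall j, positive_op (F j)) -> positive_op (\sum_(j <- s) F j).
Proof.
move=> pF; elim: s => [|j s IH]; first by rewrite big_nil; exact: pos_zero.
by rewrite big_cons; exact: pos_add.
Qed.

Lemma qf_sum (J : Type) (s : seq J) (F : J -> V -> V) x :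
  qf (\sum_(j <- s) F j) x = \sum_(j <- s) qf (F j) x.
Proof. by rewrite /qf sum_fctE /rip ip_sumr Re_sum. Qed.

Lemma trace_zero : trace ((fun=> 0) : V -> V) = 0%E.
Proof. by apply: esum1 => x _; rewrite ip0r. Qed.

Lemma trace_sum (J : eqType) (s : seq J) (F : J -> V -> V) :
  (forall j, positive_op (F j)) ->
  trace (\sum_(j <- s) F j) = (\sum_(j <- s) trace (F j))%E.
Proof.
move=> pF; elim: s => [|j s IH]; first by rewrite !big_nil; exact: trace_zero.
by rewrite !big_cons traceD ?IH//; exact: pos_sum.
Qed.

Lemma nrm_le_trace (E : V -> V) (t : R) x : positive_op E ->
  (trace E <= t%:E)%E -> nrm (E x) <= t * nrm x.
Proof.
move=> pE tE; have [|tcE nE] := traceclass_pos pE; first exact: le_lt_trans (ltry t).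
apply: nrm_le_tracenorm => //; last exact: le_trans tE.
by rewrite -lee_fin (le_trans (trace_ge0 pE)).
Qed.

Variables (J : choiceType) (F : J -> V -> V).
Hypothesis pF : forall j, positive_op (F j).
Hypothesis trF : (\esum_(j in [set: J]) trace (F j) < +oo)%E.

Let w j := fine (trace (F j)).

Let wE j : trace (F j) = (w j)%:E.
Proof.
rewrite fineK// ge0_fin_numE ?trace_ge0//; apply: le_lt_trans trF.
by have := @seq_le_esum _ _ [set: J] (fun j => trace (F j)) [:: j]; rewrite big_seq1; apply.
Qed.

Let w0 j : 0 <= w j.
Proof. by rewrite -lee_fin -wE trace_ge0. Qed.

Let t := fine (\esum_(j in [set: J]) trace (F j)).

Let tE : \esum_(j in [set: J]) (w j)%:E = t%:E.
Proof.
under eq_esum do rewrite -wE; rewrite fineK// ge0_fin_numE//.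
by apply: esum_ge0 => j _; exact: trace_ge0.
Qed.

Let wt (s : seq J) : uniq s -> \sum_(j <- s) w j <= t.
Proof. by move=> us; rewrite -lee_fin -sumEFin -tE; exact: seq_le_esum. Qed.

Let wsum (s : seq J) x : nrm (\sum_(j <- s) F j x) <= (\sum_(j <- s) w j) * nrm x.
Proof.
rewrite mulr_suml; elim/big_rec2: _ => [|j a b _ h]; first by rewrite nrm0.
by rewrite (le_trans (nrmD_le _ _))// lerD// nrm_le_trace// wE.
Qed.

Let sum_fsetD (M : nmodType) (G : J -> M) (A C : {fset J}) : fsubset A C ->
  \sum_(j <- C) G j = \sum_(j <- A) G j + \sum_(j <- fsetD C A) G j.
Proof.
move=> AC; rewrite -big_cat; apply/perm_big/uniq_perm; first exact: fset_uniq.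
  rewrite cat_uniq !fset_uniq andbT /=; apply/hasPn => j.
  by rewrite in_fsetD => /andP[].
move=> j; rewrite mem_cat in_fsetD; have /fsubsetP/(_ j) := AC.
by case: (j \in A) => //= ->.
Qed.

(** Once A carries all but e of the total weight, any larger C adds weight less than e, and the
    weight [w j] bounds the operator norm of [F j]. *)
Let tail (e : R) : 0 < e -> exists A : {fset J},
  t - e < \sum_(j <- A) w j /\ forall (C : {fset J}) x, fsubset A C ->
    nrm (\sum_(j <- C) F j x - \sum_(j <- A) F j x) <= e * nrm x.
Proof.
move=> e0; have : ((t - e)%:E < \esum_(j in [set: J]) (w j)%:E)%E.
  by rewrite tE lte_fin ltrBlDr ltrDl.
move=> /ereal_sup_gt [_ [X [finX _] <-]]; rewrite fsbig_finite//= sumEFin lte_fin.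
set A := fset_set X => hA; exists A; split=> // C x AC.
rewrite (sum_fsetD _ AC) addrC addKr (le_trans (wsum _ _))// ler_wpM2r ?nrm_ge0//.
have := wt (fset_uniq C); rewrite (sum_fsetD _ AC); lra.
Qed.

(** S is the pointwise limit along a sequence of sets [A n] with missing weight below 1 / (n + 1);
    any two of them are compared through their union. *)
Let limit : exists S : V -> V, forall e : R, 0 < e -> exists A : {fset J},
  t - e < \sum_(j <- A) w j /\ forall (C : {fset J}) x, fsubset A C ->
    nrm (S x - \sum_(j <- C) F j x) <= e * nrm x.
Proof.
have p n : 0 < (n.+1%:R^-1 : R) by rewrite invr_gt0.
have [A hA] := choice (fun n => tail (p n)).
have cau m n x : nrm (\sum_(j <- A m) F j x - \sum_(j <- A n) F j x) <=
    (m.+1%:R^-1 + n.+1%:R^-1) * nrm x.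
  have [_ hm] := hA m; have [_ hn] := hA n.
  rewrite -(subrKA (\sum_(j <- fsetU (A m) (A n)) F j x)) (le_trans (nrmD_le _ _))//.
  rewrite mulrDl lerD//; last by apply: hn; exact: fsubsetUr.
  by rewrite nrmB; apply: hm; exact: fsubsetUl.
have lim x : exists l, forall e : R, 0 < e -> exists N, forall n, (N <= n)%N ->
    nrm (\sum_(j <- A n) F j x - l) < e.
  apply: (@cauchy_limit _ _ (fun n => \sum_(j <- A n) F j x)) => e e0.
  have x1 : 0 < nrm x + 1 by rewrite ltr_wpDl ?nrm_ge0.
  have [|N hN] := inv_succ_lt (e := e / 2 / (nrm x + 1)); first by rewrite !divr_gt0.
  exists N => m n Nm Nn; rewrite (le_lt_trans (cau m n x))//.
  apply: (@le_lt_trans _ _ ((m.+1%:R^-1 + n.+1%:R^-1) * (nrm x + 1))).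
    by rewrite ler_wpM2l ?addr_ge0 ?invr_ge0// lerDl.
  rewrite -ltr_pdivlMr// (lt_le_trans (ltrD (hN _ Nm) (hN _ Nn)))//.
  by rewrite -mulrDl -splitr.
have [S hS] := choice lim; exists S => e e0.
(* One half of e is spent between a late [A n] and [A n1], the other between [A n1] and C; d absorbs
   the passage to the limit. *)
have e2 : 0 < e / 2 by rewrite divr_gt0.
have [n1 hn1] := inv_succ_lt e2; exists (A n1).
have [hw hC] := hA n1; split.
  apply: lt_trans hw; rewrite ltrD2l ltrN2 (lt_trans (hn1 _ (leqnn _)))//.
  by rewrite ltr_pdivrMr// ltr_pMr// ltr1n.
move=> C x AC.
apply: (@le_addgt0 _ (nrm x + 1)) => d d0.
have [n2 hn2] := hS x d d0; have [n3 hn3] := inv_succ_lt d0.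
pose n := maxn n2 n3.
have h1 := hn2 n (leq_maxl _ _); have h2 := hn3 n (leq_maxr _ _).
have h3 := cau n n1 x; have h4 := hC C x AC; have h5 := hn1 _ (leqnn _).
have n0 := nrm_ge0 x.
have tri (a b c d' : V) : nrm (a - b) <= nrm (c - a) + (nrm (c - d') + nrm (b - d')).
  rewrite -(subrKA c) (le_trans (nrmD_le _ _))// nrmB lerD2l.
  by rewrite -(subrKA d') (le_trans (nrmD_le _ _))// (nrmB d' b).
rewrite (le_trans (tri _ _ (\sum_(j <- A n) F j x) (\sum_(j <- A n1) F j x)))//.
have h7 : (n.+1%:R^-1 + n1.+1%:R^-1) * nrm x <= (d + e / 2) * nrm x.
  by rewrite ler_wpM2r// lerD// ltW.
have h8 : n1.+1%:R^-1 * nrm x <= e / 2 * nrm x by rewrite ler_wpM2r// ltW.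
have h9 : (d + e / 2) * nrm x + e / 2 * nrm x + d = e * nrm x + (nrm x + 1) * d by field.
rewrite -h9; apply: le_trans (lerD (ltW h1) (lerD (le_trans h3 h7) (le_trans h4 h8))) _.
by rewrite addrC.
Qed.

Lemma nrmZE (a : R[i]) (x : V) : nrm (a *: x) = Num.sqrt (sqn a) * nrm x.
Proof.
apply/eqP; rewrite -(@eqrXn2 _ 2) ?nrm_ge0 ?mulr_ge0 ?sqrtr_ge0 ?nrm_ge0//.
by rewrite nrmZ exprMn sqr_sqrtr ?sqn_ge0.
Qed.

(** The remainder of S after a finite partial sum is positive by comparison of quadratic forms, and
    its trace is the missing weight; [traceclass_pos] turns this into convergence in trace norm. *)
Lemma positive_series : exists S : V -> V, [/\ positive_op S, tsum_to F S,
  forall x, (qf S x)%:E = \esum_(j in [set: J]) (qf (F j) x)%:E &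
  trace S = \esum_(j in [set: J]) trace (F j)].
Proof.
have [S hS] := limit; exists S.
have hS1 e : 0 < e -> exists A : {fset J}, forall x,
    nrm (S x - (\sum_(j <- A) F j) x) <= e * nrm x.
  move=> e0; have [A [_ hA]] := hS e e0; exists A => x; rewrite sum_fctE.
  by apply: hA; exact: fsubset_refl.
have pA (A : {fset J}) : positive_op (\sum_(j <- A) F j) by exact: pos_sum.
have lS : linear S.
  move=> a x y; apply/subr0_eq/nrm_eq0/le_anti; rewrite nrm_ge0 andbT.
  apply: (@le_addgt0 _ (nrm (a *: x + y) + Num.sqrt (sqn a) * nrm x + nrm y)) => e e0.
  (* T is a partial sum: it is linear and close to S with an error proportional to |x|, so S
     inherits linearity. *)
  have [T [hA lA]] : exists T : V -> V, (forall x, nrm (S x - T x) <= e * nrm x) /\ linear T.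
    have [A hA] := hS1 e e0; exists (\sum_(j <- A) F j); split=> //.
    exact: pos_lin (pA A).
  rewrite add0r.
  have -> : S (a *: x + y) - (a *: S x + S y) =
      (S (a *: x + y) - T (a *: x + y)) + (- (a *: (S x - T x)) - (S y - T y)).
    have zz (p q r u v : V) : p - (u + v) = (p - (q + r)) + (- (u - q) - (v - r)).
      by rewrite !opprB [q - u + _]addrACA  [RHS]addrA subrK opprD.
    by rewrite lA scalerBr; exact: zz.
  rewrite (le_trans (nrmD_le _ _))// !mulrDl -addrA lerD//.
    by rewrite mulrC hA.
  rewrite (le_trans (nrmD_le _ _))// !nrmN nrmZE lerD// -?mulrA ?ler_wpM2l ?sqrtr_ge0//.
    by rewrite mulrC hA.
  by rewrite mulrC hA.
have rS x y e : 0 < e -> exists A : {fset J},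
    `|rip y (S x) - rip y ((\sum_(j <- A) F j) x)| <= nrm y * nrm x * e /\
    `|rip x (S y) - rip x ((\sum_(j <- A) F j) y)| <= nrm y * nrm x * e.
  move=> e0; have [A hA] := hS1 e e0; exists A.
  have hh u v : `|rip u (S v) - rip u ((\sum_(j <- A) F j) v)| <= nrm u * nrm v * e.
    rewrite -ripBr ler_norml lerNl -ripNr; apply/andP; split.
      by rewrite (le_trans (rip_le _ _))// nrmN -mulrA ler_wpM2l ?nrm_ge0// mulrC.
    by rewrite (le_trans (rip_le _ _))// -mulrA ler_wpM2l ?nrm_ge0// mulrC.
  by split; [exact: hh|rewrite [nrm y * _]mulrC; exact: hh].
have saS x y : ip y (S x) = ip (S y) x.
  apply/esym; apply: (@rip_ipE _ _ (S y) (fun x => ip y (S x))) => [a u|u].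
    by rewrite (linZ lS) ipZ.
  apply/eqP; rewrite -subr_eq0 -normr_le0; rewrite -/(rip y (S u)) (ripC (S y)).
  apply: (@le_addgt0 _ (2 * (nrm y * nrm u))) => e e0.
  have [A [h1 h2]] := rS u y e e0; rewrite add0r.
  have h3 : rip u ((\sum_(j <- A) F j) y) = rip y ((\sum_(j <- A) F j) u).
    by rewrite (pos_rip _ _ (pA A)) ripC.
  move: h1 h2; rewrite h3 !ler_norml => /andP[? ?] /andP[? ?].
  by apply/andP; split; lra.
have qS x e : 0 < e -> exists A : {fset J},
    `|qf S x - \sum_(j <- A) qf (F j) x| <= nrm x * nrm x * e.
  by move=> e0; have [A [h1 _]] := rS x x e e0; exists A; rewrite -qf_sum.
have qSE x : (qf S x)%:E = \esum_(j in [set: J]) (qf (F j) x)%:E.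
  apply/eqP; rewrite eq_le; apply/andP; split.
    apply/lee_addgt0Pr => e e0.
    have n1 : 0 < nrm x * nrm x + 1 by rewrite ltr_wpDl// mulr_ge0 ?nrm_ge0.
    have [|A hA] := qS x (e / (nrm x * nrm x + 1)); first by rewrite divr_gt0.
    apply: (@le_trans _ _ ((\sum_(j <- A) qf (F j) x)%:E + e%:E)%E).
      rewrite -EFinD lee_fin -lerBlDl (le_trans (ler_norm _))// (le_trans hA)//.
      by rewrite mulrA ler_pdivrMr// mulrC ler_pM2l// lerDl.
    by rewrite leeD2r// -sumEFin; apply: seq_le_esum; [exact: fset_uniq|by []].
  apply: esum_le_seq => s us _; rewrite lee_fin.
  apply: (@le_addgt0 _ (nrm x * nrm x)) => e e0.
  have [A [_ hA]] := hS e e0.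
  (* Adding A to s makes the estimate of [limit] available and only enlarges the sum of nonnegative
     terms. *)
  pose C := fsetU A [fset j in s]%fset.
  have hC := hA C x (fsubsetUl _ _).
  have sC : \sum_(j <- s) qf (F j) x <= \sum_(j <- C) qf (F j) x.
    have sC : fsubset [fset j in s]%fset C by exact: fsubsetUr.
    rewrite (sum_fsetD (fun j => qf (F j) x) sC).
    rewrite (perm_big [fset j in s]%fset) /=.
      by rewrite lerDl sumr_ge0// => j _; exact: qf_ge0.
    by apply: uniq_perm => // j; rewrite inE.
  rewrite (le_trans sC)// -lerBlDl -qf_sum /qf -ripBr (le_trans (rip_le _ _))//.
  by rewrite -mulrA ler_wpM2l ?nrm_ge0// nrmB sum_fctE mulrC.
have bS : bounded_op S.
  apply/bounded_opP; split=> //; have [A hA] := hS1 1 ltr01.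
  have /bounded_opP [_ [c c0 hc]] := pos_bdd (pA A).
  exists (1 + c) => [|x]; first by rewrite addr_ge0.
  rewrite -[S x](subrK ((\sum_(j <- A) F j) x)) (le_trans (nrmD_le _ _))//.
  by rewrite mulrDl lerD.
have pS : positive_op S.
  apply: positiveI => // x; rewrite -lee_fin qSE; apply: esum_ge0 => j _.
  by rewrite lee_fin qf_ge0.
have tS : trace S = \esum_(j in [set: J]) trace (F j).
  rewrite /trace (eq_esum (b := fun b => \esum_(j in [set: J]) (`|qf (F j) b|)%:E)).
    rewrite esum_exchange//; apply: eq_esum => j _; apply: eq_esum => b _.
    by rewrite ger0_norm ?qf_ge0.
  move=> b _; rewrite -/(rip b (S b)) -/(qf S b) qSE; apply: eq_esum => j _.
  by rewrite ger0_norm ?qf_ge0.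
split=> // e e0; have [A [wA _]] := tail e0; exists A => B AB E.
have pE : positive_op E.
  apply: pos_sub => // x; rewrite -lee_fin qSE qf_sum -sumEFin.
  by apply: seq_le_esum; [exact: fset_uniq|by []].
have SE : S = E + \sum_(j <- B) F j by rewrite /E subrK.
have trE : (trace E + (\sum_(j <- B) w j)%:E = t%:E)%E.
  rewrite -tE; under eq_esum do rewrite -wE.
  rewrite -tS SE traceD// trace_sum// -sumEFin; congr (_ + _)%E.
  by apply: eq_bigr => j _; rewrite wE.
have trlt : (trace E < e%:E)%E.
  have : \sum_(j <- A) w j <= \sum_(j <- B) w j.
    by rewrite (sum_fsetD _ AB) lerDl sumr_ge0.
  have := trace_ge0 pE; move: (trace E) trE => [r||]//=.
  by rewrite -EFinD => -[] ? _ ?; rewrite lte_fin; lra.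
have [|tcE nE] := traceclass_pos pE; first exact: lt_trans trlt (ltry _).
by split=> //; exact: le_lt_trans trlt.
Qed.

End PositiveSeries.

Section Limits.
Context {R : realType}.
Implicit Types V W : hilbertType R.

Lemma sqn_eq0 (z : R[i]) : sqn z = 0 -> z = 0.
Proof.
case: z => a b /eqP; rewrite /sqn /= paddr_eq0 ?sqr_ge0// !sqrf_eq0.
by move=> /andP[/eqP -> /eqP ->].
Qed.

(** Meant for sums in which orthogonality of the sites leaves at most one nonzero term, so that the
    partial sums are eventually constant. *)
Lemma ip_tsum V (I : choiceType) (F : I -> V -> V) (S : V -> V) x y (c : R[i])
    (A : {fset I}) : tsum_to F S ->
  (forall B : {fset I}, fsubset A B -> \sum_(j <- B) ip y (F j x) = c) ->
  ip y (S x) = c.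
Proof.
move=> FS hc; apply/subr0_eq/sqn_eq0/le_anti; rewrite sqn_ge0 andbT.
apply: (@le_addgt0 _ (nrm y ^+ 2 * nrm x ^+ 2)) => e e0.
have se0 : 0 < Num.sqrt e by rewrite sqrtr_gt0.
have [A' hA'] := tsum_to_strong FS se0.
have := hA' _ (fsubsetUr A A') x; set B := fsetU A A' => h.
rewrite add0r -(hc B (fsubsetUl _ _)) -ip_sumr -ipB (le_trans (CS_ip _ _))//.
rewrite -mulrA ler_wpM2l ?sqr_ge0// -(sqr_sqrtr (ltW e0)) -exprMn mulrC.
by rewrite ler_sqr ?nnegrE ?mulr_ge0 ?sqrtr_ge0 ?nrm_ge0.
Qed.

Lemma op_ext V W (A B : V -> W) : (forall x y, ip y (A x) = ip y (B x)) -> A = B.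
Proof. by move=> h; apply/funext => x; apply: ip_ext => z; rewrite /rip h. Qed.

Lemma esum_if_eq (I : choiceType) (i : I) (c : \bar R) : (0 <= c)%E ->
  \esum_(l in [set: I]) (if l == i then c else 0%E) = c.
Proof.
move=> c0; rewrite -[RHS](@esum_set1 _ _ i (fun=> c))// [RHS]esum_mkcond.
apply: eq_esum => l _; have [->|li] := eqVneq l i; first by rewrite mem_set.
by case: ifPn => //; rewrite inE /= => /eqP; rewrite (negbTE li).
Qed.

End Limits.

(** * The walk on a tensor product *)

Section Walk.
Context {R : realType} {D : distset} {H K : hilbertType R}.
Variables (T : htensor H K) (e : idx D -> K).
Hypothesis he : onbasis_family e.

(* [site i] is U_i, and [mass X i] is Tr(U_i^* X U_i). *)
Definition site (i : idx D) (x : H) : T := tens T x (e i).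

Let site_ip i l x y : ip (site i x) (site l y) = (i == l)%:R * ip x y.
Proof. by rewrite /site ip_tens he.1 mulrC. Qed.

Let site_iso i : isometry_op (site i).
Proof.
split; first by move=> a x y; exact: tensDl.
move=> x; rewrite !normE; congr (_ %:C%C); apply/eqP.
by rewrite -(@eqrXn2 _ 2) ?nrm_ge0// -!rip_diag /rip site_ip eqxx mul1r.
Qed.

Let site_bdd i : bounded_op (site i).
Proof. exact: isometry_bounded. Qed.

Let site_adj_tens i x y : adjoint (site i) (tens T x y) = ip (e i) y *: x.
Proof.
apply: ip_ext => z; rewrite ripC [RHS]ripC /rip -adjointE// ip_tens.
by rewrite ipZl mulrC -ip_conj.
Qed.

Let site_adj i l x : adjoint (site i) (site l x) = if i == l then x else 0.
Proof. by rewrite site_adj_tens he.1; case: eqP; rewrite ?scale1r ?scale0r. Qed.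

(** For fixed x the map y |-> x ⊗ y is bounded; its adjoint sends z to a vector orthogonal to every
    e_i, hence to 0. *)
Let site_total z : (forall i x, ip (site i x) z = 0) -> z = 0.
Proof.
move=> h; apply: (ortho_lspan0 (@tens_dense _ _ _ T)) => _ [x [y ->]].
have bx : bounded_op (fun y : K => tens T x y).
  apply/bounded_opP; split; first by move=> a u v; exact: tensDr.
  exists (nrm x) => [|u]; first exact: nrm_ge0.
  rewrite -ler_sqr ?nnegrE ?mulr_ge0 ?nrm_ge0// exprMn -rip_diag /rip ip_tens.
  by rewrite !ip_diag ReZ.
rewrite (adjointEr bx y z) (_ : adjoint _ z = 0) ?ip0r//.
by apply: (ortho_lspan0 he.2) => _ [i _ <-]; rewrite -adjointEr//; exact: h.
Qed.

(** The operator chosen by [optens] is prescribed on elementary tensors, which are total, so it must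
    be U_i B U_j^* there and everywhere. *)
Let optensE (B : H -> H) i j : bounded_op B ->
  optens T B (ketbra (e i) (e j)) = site i \o B \o adjoint (site j).
Proof.
move=> bB; set P := [set M : T -> T | bounded_op M /\
  forall x y, M (tens T x y) = tens T (B x) (ketbra (e i) (e j) y)].
have hP : P (site i \o B \o adjoint (site j)).
  split.
    apply: bounded_comp; first exact: adjoint_bounded.
    exact: bounded_comp.
  move=> x y /=; rewrite site_adj_tens (linZ (bounded_op_lin bB)) /ketbra /site.
  have := tensDl T (ip (e j) y) (B x) 0 (e i); rewrite addr0 => ->.
  have := tensDr T (ip (e j) y) (B x) (e i) 0; rewrite addr0 => ->.
  by have := tensDl T (-1) 0 0 (e i); have := tensDr T (-1) (B x) 0 0;
    rewrite !scaler0 !addr0 !scaleN1r !addNr => -> ->.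
have [b1 h1] : P (optens T B (ketbra (e i) (e j))) by apply: getPex; eexists; exact: hP.
have [b2 h2] := hP.
apply: (bounded_eq b1 b2 (@tens_dense _ _ _ T)) => _ [x [y ->]].
by rewrite h1 h2.
Qed.

Definition block (X : T -> T) (i : idx D) : H -> H := adjoint (site i) \o X \o site i.
Definition mass (X : T -> T) (i : idx D) : \bar R := trace (block X i).

Let block_pos X i : positive_op X -> positive_op (block X i).
Proof. exact: pos_conj_adj. Qed.

Let qf_block X i x : qf (block X i) x = qf X (site i x).
Proof. exact: qf_conj_adj. Qed.

Lemma mass_ge0 X i : positive_op X -> (0 <= mass X i)%E.
Proof. by move=> pX; apply/trace_ge0/block_pos. Qed.

Let massE X i : mass X i = \esum_(b in hbasis H) (qf X (site i b))%:E.
Proof. by apply: eq_esum => b _; congr EFin; exact: qf_block. Qed.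

(** The vectors b ⊗ e_i are orthonormal, so [bessel_trace] applies to every finite selection of
    them. *)
Lemma mass_sum_le X : positive_op X -> (\esum_(i in [set: idx D]) mass X i <= trace X)%E.
Proof.
move=> pX; under eq_esum do rewrite massE.
rewrite esum_esum; last by move=> *; rewrite lee_fin qf_ge0.
apply: (@esum_le_seq _ _ _ (fun k => qf X (site k.1 k.2))) => s us sb.
apply: (@bessel_trace _ _ _ _ s (fun k => site k.1 k.2)) => //.
apply: on_bessel => // -[i b] [l c] /sb [_ /= hb] /sb [_ /= hc].
rewrite site_ip (hbasisP (V := H)).1// xpair_eqE.
by case: (i == l); case: (b == c); rewrite ?mulr0 ?mul0r ?mulr1.
Qed.

Let mass_fin X i : positive_op X -> (trace X < +oo)%E -> (mass X i < +oo)%E.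
Proof.
move=> pX tX; apply: le_lt_trans tX; apply: le_trans (mass_sum_le pX).
by have := @seq_le_esum _ _ [set: idx D] (mass X) [:: i]; rewrite big_seq1; apply.
Qed.

Definition block_diag (X : T -> T) :=
  forall i l x y, i != l -> ip (site i y) (X (site l x)) = 0.

Let is_blocks_uniq sigma s : is_blocks e sigma s -> forall i, s i = block sigma i.
Proof.
move=> [hs ts] i; apply: op_ext => x y; rewrite /block /= -adjointEr//.
apply/esym/(ip_tsum (A := fset1 i) ts) => B iB.
have Bi : i \in B by move/fsubsetP: iB; apply; rewrite inE.
rewrite (bigD1_seq i) ?fset_uniq//= [X in _ + X]big1 ?addr0 => [|j ji].
  rewrite optensE; last by case: (hs i) => [[]].
  by rewrite /= site_adj eqxx site_ip eqxx mul1r.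
rewrite optensE; last by case: (hs j) => [[]].
by rewrite /= site_ip eq_sym (negbTE ji) mul0r.
Qed.

(** What needs proof is that blocks exist: the diagonal blocks have summable traces, so their series
    converges to some S, and S has the same matrix elements between sites as sigma. *)
Lemma dist_mass sigma i : positive_op sigma -> (trace sigma < +oo)%E ->
  block_diag sigma -> dist e sigma i = mass sigma i.
Proof.
move=> ps ts bd; rewrite /dist.
suff hb : is_blocks e sigma (block sigma).
  by rewrite (is_blocks_uniq (getPex (ex_intro _ _ hb))).
have pb j := block_pos j ps.
have [||S [pS FS _ _]] := @positive_series _ _ _
  (fun j => site j \o block sigma j \o adjoint (site j)).
- by move=> j; exact: pos_conj.
- apply: le_lt_trans ts; apply: le_trans (mass_sum_le ps).
  by apply: le_esum => j _; rewrite trace_isometry.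
have SE l x : S (site l x) = sigma (site l x).
  apply/subr0_eq/site_total => j y; rewrite ipB.
  suff -> : ip (site j y) (S (site l x)) = ip (site j y) (sigma (site l x)) by rewrite subrr.
  have [jl|jl] := eqVneq j l; last first.
    rewrite bd//; apply: (ip_tsum (A := fset0) FS) => B _.
    apply: big1 => a _ /=; rewrite site_adj.
    case: eqP => [al|_]; first by rewrite site_ip al (negbTE jl) mul0r.
    have pba := pb a; rewrite (lin0 (pos_lin pba)) site_ip ip0r mulr0//.
  rewrite jl; apply: (ip_tsum (A := fset1 l) FS) => B lB.
  have Bl : l \in B by move/fsubsetP: lB; apply; rewrite inE.
  rewrite (bigD1_seq l) ?fset_uniq//= [X in _ + X]big1 ?addr0 => [|a al].
    by rewrite site_adj eqxx site_ip eqxx mul1r /block /= -adjointEr.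
  by rewrite site_ip eq_sym (negbTE al) mul0r.
(* Self-adjointness moves both operators onto the site vectors, where they agree; totality of these
   vectors then suffices. *)
have Ss : S = sigma.
  apply/funext => w; apply/subr0_eq/site_total => j x.
  by rewrite ipB (pos_sa pS) (pos_sa ps) SE subrr.
split=> [j|].
  split; last exact: pb.
  have [|//] := traceclass_pos (pb j).
  exact: (mass_fin j ps ts).
move: FS; rewrite Ss; congr (tsum_to _ sigma); apply/funext => j.
by rewrite optensE//; exact: pos_bdd.
Qed.

Section Combination.
Variables (J : eqType) (s : seq J) (c : J -> R) (X : J -> T -> T).
Hypothesis c0 : forall j, 0 <= c j.
Hypothesis pX : forall j, positive_op (X j).

Lemma pos_lincomb : positive_op (\sum_(j <- s) (c j)%:C%C *: X j).
Proof. by apply: pos_sum => j; exact: pos_scale. Qed.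

Lemma trace_lincomb : (forall j, (trace (X j) < +oo)%E) ->
  (trace (\sum_(j <- s) (c j)%:C%C *: X j)%R < +oo)%E.
Proof.
move=> tX; rewrite trace_sum => [|j]; last exact: pos_scale.
apply: lte_sum_pinfty => j _; rewrite traceZ//.
have -> : trace (X j) = (fine (trace (X j)))%:E.
  by rewrite fineK// ge0_fin_numE ?tX// trace_ge0.
by rewrite -EFinM ltry.
Qed.

Lemma block_diag_lincomb : (forall j, block_diag (X j)) ->
  block_diag (\sum_(j <- s) (c j)%:C%C *: X j).
Proof.
move=> bX i l x y il; rewrite sum_fctE ip_sumr big1// => j _.
rewrite [X in ip _ X](_ : _ = (c j)%:C%C *: X j (site l x))//.
by rewrite ipZ bX// mulr0.
Qed.

Lemma mass_lincomb i : mass (\sum_(j <- s) (c j)%:C%C *: X j) i =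
  (\sum_(j <- s) (c j)%:E * mass (X j) i)%E.
Proof.
transitivity (trace (\sum_(j <- s) (c j)%:C%C *: block (X j) i)).
  rewrite massE; apply: eq_esum => b _; congr EFin.
  rewrite -/(rip b _) -/(qf _ b) !qf_sum; apply: eq_bigr => j _.
  by rewrite !qfZ qf_block.
rewrite trace_sum => [|j]; last exact/pos_scale/block_pos.
by apply: eq_bigr => j _; rewrite traceZ//; exact: block_pos.
Qed.

End Combination.

(** * One step of the walk *)

Variables (B U : idx D -> idx D -> idx D -> H -> H) (q : idx D -> idx D -> idx D -> R).
Hypothesis hU : forall i j k, isometry_op (U i j k).
Hypothesis q0 : forall i j k, 0 <= q k j i.
Hypothesis q1 : forall k j s, uniq s -> \sum_(i <- s) q k j i <= 1.
Hypothesis hB : forall i j k,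
  exists2 c : R[i], c^* * c = (q k j i)%:C%C & B i j k = c *: U i j k.

Let term k X ij : T -> T :=
  let M := optens T (B ij.1 ij.2 k) (ketbra (e ij.1) (e ij.2)) in M \o X \o adjoint M.

Let WU i j k : isometry_op (site i \o U i j k).
Proof.
split=> [a x y /=|x /=].
  by case: (hU i j k) => -> _; case: (site_iso i) => ->.
by case: (site_iso i) => _ ->; case: (hU i j k) => _ ->.
Qed.

(** M = c W U_j^* with the isometry W = U_i U_{i,j;k}; the two scalars combine to c^* c = q, so the
    phase of c cancels and X enters only through its block at j. *)
Let termE k X i j : positive_op X -> term k X (i, j) =
  (q k j i)%:C%C *: ((site i \o U i j k) \o block X j \o adjoint (site i \o U i j k)).
Proof.
move=> pX; have [c cq BE] := hB i j k; rewrite /term /=.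
have bU := isometry_bounded (hU i j k); have bW := isometry_bounded (WU i j k).
have bB : bounded_op (B i j k) by rewrite BE; exact: bounded_scale.
rewrite optensE//; set M := _ \o adjoint (site j).
have ME x : M x = c *: site i (U i j k (adjoint (site j) x)).
  by rewrite /M BE /= -(linZ (proj1 (site_iso i))).
have bM : bounded_op M.
  by apply: bounded_comp; [exact: adjoint_bounded|exact: bounded_comp].
have -> : adjoint M = c^* *: (site j \o adjoint (site i \o U i j k)).
  apply: adjoint_uniq => // x y; rewrite ME ipZ.
  rewrite (_ : (c^* *: _) y = c^* *: site j (adjoint (site i \o U i j k) y))//.
  by rewrite ipZl conjCK (adjointEr (site_bdd j)) -(adjointE bW).
apply/funext => x /=.
rewrite [LHS](_ : _ = M (X (c^* *: site j (adjoint (site i \o U i j k) x))))//.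
rewrite ME (linZ (pos_lin pX)) (linZ (bounded_op_lin (adjoint_bounded (site_bdd j)))).
rewrite (linZ (bounded_op_lin (isometry_bounded (hU i j k)))).
rewrite (linZ (bounded_op_lin (site_bdd i))) scalerA [c * _]mulrC cq.
by [].
Qed.

Let term_pos k X ij : positive_op X -> positive_op (term k X ij).
Proof.
case: ij => i j pX; rewrite termE//; apply: pos_scale => //.
by apply: pos_conj; [exact/isometry_bounded/WU|exact: block_pos].
Qed.

Let term_trace k X i j : positive_op X ->
  trace (term k X (i, j)) = ((q k j i)%:E * mass X j)%E.
Proof.
move=> pX; have pb := block_pos j pX; have iW := WU i j k.
by rewrite termE// traceZ// ?trace_isometry//; apply: pos_conj => //; exact: isometry_bounded.
Qed.

Let WU_adj i l j k x : adjoint (site l \o U l j k) (site i x) =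
  if i == l then adjoint (U l j k) x else 0.
Proof.
have bU := isometry_bounded (hU l j k); have bW := isometry_bounded (WU l j k).
apply: ip_ext => z; rewrite ripC [RHS]ripC /rip -adjointE//= site_ip.
by case: eqP => _; rewrite ?mul1r ?mul0r ?ip0l// adjointE.
Qed.

Lemma setTXR (I J : Type) : [set: I * J] = [set: I] `*`` (fun=> [set: J]).
Proof. by apply/seteqP; split. Qed.

(** Summing over the target i first weights each mass by a column sum, at most 1, and the masses add
    up to at most the trace. *)
Let term_sum k X : positive_op X -> (trace X < +oo)%E ->
  (\esum_(ij in [set: idx D * idx D]) trace (term k X ij) < +oo)%E.
Proof.
move=> pX tX; apply: le_lt_trans (tX); apply: le_trans (mass_sum_le pX).
rewrite (eq_esum (b := fun ij => ((q k ij.2 ij.1)%:E * mass X ij.2)%E)); last first.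
  by move=> [i j] _; rewrite term_trace.
have qm i j : (0 <= (q k j i)%:E * mass X j)%E by rewrite mule_ge0 ?lee_fin ?mass_ge0.
rewrite setTXR -(@esum_esum _ _ _ _ _ (fun i j => ((q k j i)%:E * mass X j)%E))//.
rewrite esum_exchange//; apply: le_esum => j _.
have m0 := mass_ge0 j pX; have mf := mass_fin j pX tX.
have -> : mass X j = (fine (mass X j))%:E by rewrite fineK// ge0_fin_numE.
under eq_esum do rewrite muleC.
rewrite esumZ ?fine_ge0//; last by move=> i; rewrite lee_fin.
rewrite -[leRHS]mule1 lee_wpmul2l ?lee_fin ?fine_ge0//.
by apply: esum_le_seq => s us _; rewrite lee_fin; exact: q1.
Qed.

Lemma oqrw_step k X : positive_op X -> (trace X < +oo)%E ->
  [/\ positive_op (oqrw e B k X), (trace (oqrw e B k X) < +oo)%E,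
      block_diag (oqrw e B k X) &
      forall i, mass (oqrw e B k X) i =
        \esum_(j in [set: idx D]) ((q k j i)%:E * mass X j)%E].
Proof.
move=> pX tX; have pT ij := term_pos k ij pX.
have [S [pS FS qS tS]] := positive_series pT (term_sum k pX tX).
have -> : oqrw e B k X = S by exact: tsumE (pos_bdd pS) FS.
split=> //; first by rewrite tS; exact: term_sum.
  move=> i l x y il; apply: (ip_tsum (A := fset0) FS) => A _.
  apply: big1 => -[a j] _; rewrite termE//.
  rewrite [X in ip _ X](_ : _ = (q k j a)%:C%C *: site a (U a j k (block X j
    (adjoint (site a \o U a j k) (site l x)))))//.
  rewrite ipZ site_ip; have [ia|_] := eqVneq i a; last by rewrite mul0r mulr0.
  rewrite WU_adj -ia eq_sym (negbTE il) (lin0 (pos_lin (block_pos j pX))).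
  by rewrite (lin0 (proj1 (hU i j k))) ip0r !mulr0.
move=> i; rewrite massE.
under eq_esum do rewrite qS.
rewrite esum_exchange; last by move=> *; rewrite lee_fin; exact: qf_ge0.
rewrite setTXR -(@esum_esum _ _ _ _ _ (fun l j =>
  \esum_(b in hbasis H) (qf (term k X (l, j)) (site i b))%:E)); last first.
  by move=> *; apply: esum_ge0 => *; rewrite lee_fin; exact: qf_ge0.
have qm j : (0 <= (q k j i)%:E * mass X j)%E by rewrite mule_ge0 ?lee_fin ?mass_ge0.
(* The term (l, j) has its range in site l, so it contributes to the mass at i for l = i only. *)
transitivity (\esum_(l in [set: idx D]) \esum_(j in [set: idx D])
    (if l == i then (q k j i)%:E * mass X j else 0)%E).
  apply: eq_esum => l _; apply: eq_esum => j _.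
  have pUX : positive_op (U l j k \o block X j \o adjoint (U l j k)).
    by apply: pos_conj; [exact/isometry_bounded/hU|exact: block_pos].
  have qE b : qf (term k X (l, j)) (site i b) =
      if l == i then
        qf ((q k j l)%:C%C *: (U l j k \o block X j \o adjoint (U l j k))) b
      else 0.
    rewrite termE// !qfZ !qf_conj ?WU_adj; try exact: isometry_bounded.
    rewrite eq_sym; case: eqP => // _.
    by rewrite /qf /rip ip0l mulr0.
  under eq_esum do rewrite qE.
  have [->|_] := eqVneq l i; last exact: esum1.
  have := traceZ (q0 i j k) (pos_conj (isometry_bounded (hU i j k)) (block_pos j pX)).
  by rewrite (trace_isometry (hU i j k) (block_pos j pX)) => <-.
rewrite esum_exchange; last by move=> l j; case: ifP.
by apply: eq_esum => j _; rewrite esum_if_eq.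
Qed.

End Walk.

(** * Structure constants *)

Lemma Real_sum {R : realType} (I : Type) (s : seq I) (P : pred I) (F : I -> R) :
  (\sum_(i <- s | P i) F i)%:C%C = \sum_(i <- s | P i) ((F i)%:C%C : R[i]).
Proof. by elim/big_rec2: _ => //= i x y _ <-; rewrite RealD. Qed.

Section HypergroupAlgebra.
Context {R : realType} {D : distset} (G : hypergroup R D).
Implicit Types (u v w : CH R D) (i j k l m : idx D).

Lemma hx_decomp u : u = \sum_(k <- msupp u) mcoeff k u *: hx R k.
Proof.
rewrite {1}[u]monalgE; apply: eq_bigr => k _; apply/malgP => l.
by rewrite mcoeffZ !mcoeffU; case: eqP; rewrite ?mulr1 ?mulr0.
Qed.

Lemma mcoeff_bigsum (I : Type) (s : seq I) (F : I -> CH R D) k :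
  mcoeff k (\sum_(i <- s) F i) = \sum_(i <- s) mcoeff k (F i).
Proof. by elim: s => [|i s IH]; rewrite ?big_nil ?mcoeff0// !big_cons mcoeffD IH. Qed.

Lemma hop_suml (I : Type) (s : seq I) (a : I -> R[i]) (F : I -> CH R D) w :
  hop G (\sum_(i <- s) a i *: F i) w = \sum_(i <- s) a i *: hop G (F i) w.
Proof.
elim: s => [|i s IH]; last by rewrite !big_cons hopDl IH.
rewrite !big_nil; have := hopDl G (-1) 0 0 w.
by rewrite scaler0 addr0 scaleN1r addNr.
Qed.

Lemma hop_sumr (I : Type) (s : seq I) (a : I -> R[i]) (F : I -> CH R D) w :
  hop G w (\sum_(i <- s) a i *: F i) = \sum_(i <- s) a i *: hop G w (F i).
Proof.
elim: s => [|i s IH]; last by rewrite !big_cons hopDr IH.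
rewrite !big_nil; have := hopDr G (-1) 0 0 w.
by rewrite scaler0 addr0 scaleN1r addNr.
Qed.

Lemma mcoeff_hopl u j i : mcoeff i (hop G u (hx R j)) =
  \sum_(m <- msupp u) mcoeff m u * strconst G m j i.
Proof.
rewrite {1}[u]hx_decomp hop_suml mcoeff_bigsum; apply: eq_bigr => m _.
by rewrite mcoeffZ.
Qed.

Lemma mcoeff_hopr k u i : mcoeff i (hop G (hx R k) u) =
  \sum_(l <- msupp u) mcoeff l u * strconst G k l i.
Proof.
rewrite {1}[u]hx_decomp hop_sumr mcoeff_bigsum; apply: eq_bigr => m _.
by rewrite mcoeffZ.
Qed.

Definition rstrconst k j i : R := complex.Re (strconst G k j i).

(** The filtered sum has at most one term; being empty for i beyond m, it gives the coefficient 0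
    there without a case distinction. *)
Lemma strconst_convex k j : exists (m : idx D) (q : nat -> R),
  [/\ forall n, (n <= val m)%N -> 0 <= q n, \sum_(l < (val m).+1) q l = 1 &
    forall i, strconst G k j i = (\sum_(l < (val m).+1 | idx_below l == i) q l)%:C%C].
Proof.
have [m [q [q0 q1 qE]]] := hop_convex G k j; exists m, q; split=> // i.
rewrite /strconst qE mcoeff_bigsum Real_sum [RHS]big_mkcond /=.
apply: eq_bigr => l _; rewrite mcoeffZ mcoeffU.
by case: eqP; rewrite ?mulr1 ?mulr0.
Qed.

Lemma strconstE k j i : strconst G k j i = (rstrconst k j i)%:C%C.
Proof. by rewrite /rstrconst; have [m [q [_ _ ->]]] := strconst_convex k j. Qed.

Lemma rstrconst_ge0 k j i : 0 <= rstrconst k j i.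
Proof.
rewrite /rstrconst; have [m [q [q0 _ ->]]] := strconst_convex k j.
by apply: sumr_ge0 => l _; apply: q0; rewrite -ltnS.
Qed.

Lemma rstrconst_sum_le1 k j s : uniq s -> \sum_(i <- s) rstrconst k j i <= 1.
Proof.
move=> us; have [m [q [q0 <- qE]]] := strconst_convex k j.
under eq_bigr do rewrite /rstrconst qE /=.
rewrite (exchange_big_dep predT)//=; apply: ler_sum => l _.
have ql : 0 <= q l by apply: q0; rewrite -ltnS.
rewrite -big_filter (@eq_filter _ _ (pred1 (idx_below l))) => [|i]; last by rewrite /= eq_sym.
have [ls|ls] := boolP (idx_below l \in s); first by rewrite filter_pred1_uniq// big_seq1.
rewrite (_ : [seq _ <- _ | _] = [::]) ?big_nil//.
by apply/eqP; rewrite -[_ == _]negbK -has_filter; apply: contra ls => /hasP[i si /eqP <-].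
Qed.

(** Left multiplication by the product of the letters; at the unit it is the element behind
    [multiconst]. *)
Definition word (s : seq (idx D)) u : CH R D := foldr (fun k v => hop G (hx R k) v) u s.
(** Entry (i, j) of the matrix of this left multiplication, a product of matrices of structure
    constants. *)
Definition wordconst s j i : R := complex.Re (mcoeff i (word s (hx R j))).

Lemma wordE s j i : mcoeff i (word s (hx R j)) = (wordconst s j i)%:C%C /\ 0 <= wordconst s j i.
Proof.
rewrite /wordconst; elim: s i => [|k s IH] i /=.
  by rewrite mcoeffU; case: eqP.
have -> : mcoeff i (hop G (hx R k) (word s (hx R j))) =
    (\sum_(l <- msupp (word s (hx R j))) wordconst s j l * rstrconst k l i)%:C%C.
  rewrite mcoeff_hopr Real_sum.
  by apply: eq_bigr => l _; rewrite (proj1 (IH l)) strconstE -RealM.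
by split=> //=; apply: sumr_ge0 => l _; rewrite mulr_ge0 ?rstrconst_ge0//; case: (IH l).
Qed.

Lemma wordconst_cons k s j i : wordconst (k :: s) j i =
  \sum_(l <- msupp (word s (hx R j))) rstrconst k l i * wordconst s j l.
Proof.
rewrite {1}/wordconst /= mcoeff_hopr Re_sum; apply: eq_bigr => l _.
by rewrite (proj1 (wordE s j l)) strconstE -RealM mulrC.
Qed.

Lemma wordconst_out s j l : l \notin msupp (word s (hx R j)) -> wordconst s j l = 0.
Proof. by move=> h; rewrite /wordconst mcoeff_outdom. Qed.

Lemma word_hop s u v : word s (hop G u v) = hop G (word s u) v.
Proof. by elim: s => //= k s ->; rewrite hopA. Qed.

(** Write x_j as x_0 o x_j and rebracket: the word acts on x_0 alone, and expanding the result in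
    the basis leaves single products x_m o x_j. *)
Lemma wordconst_multi s j i : wordconst s j i =
  \sum_(m <- msupp (word s (hx R (idx0 D)))) wordconst s (idx0 D) m * rstrconst m j i.
Proof.
rewrite {1}/wordconst -[hx R j](hop1l G) word_hop mcoeff_hopl Re_sum; apply: eq_bigr => m _.
by rewrite (proj1 (wordE s _ m)) strconstE -RealM.
Qed.

End HypergroupAlgebra.

Lemma esum_finsupp {R : realType} (I : choiceType) (A : {fset I}) (f : I -> \bar R) :
  (forall i, (0 <= f i)%E) -> (forall i, i \notin A -> f i = 0%E) ->
  \esum_(i in [set: I]) f i = (\sum_(i <- A) f i)%E.
Proof.
move=> f0 fA; rewrite (esumID [set` A])// setTI esum_fset//.
rewrite -fsbig_seq ?fset_uniq// [X in (_ + X)%E]esum1 ?adde0//.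
by move=> i [_ /= /negP]; exact: fA.
Qed.

(** * Masses along the walk and the comparison of distributions *)

Section Evolution.
Context {R : realType} {D : distset} (G : hypergroup R D) {H K : hilbertType R}.
Variables (T : htensor H K) (e : idx D -> K) (U : idx D -> idx D -> idx D -> H -> H).
Hypothesis he : onbasis_family e.
Hypothesis hU : forall i j k, isometry_op (U i j k).

Let M := oqrw (T := T) e (hypergroup_B G U).

Let M_step k X : positive_op X -> (trace X < +oo)%E ->
  [/\ positive_op (M k X), (trace (M k X) < +oo)%E, block_diag e (M k X) &
      forall i, mass e (M k X) i =
        \esum_(j in [set: idx D]) ((rstrconst G k j i)%:E * mass e X j)%E].
Proof.
apply: (oqrw_step he hU (q := rstrconst G)).
- by move=> *; exact: rstrconst_ge0.
- by move=> *; exact: rstrconst_sum_le1.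
move=> i j l; exists (sqrtC (strconst G l j i)) => //.
have s0 : 0 <= strconst G l j i by rewrite strconstE lecR rstrconst_ge0.
by rewrite -strconstE geC0_conj ?sqrtC_ge0// -expr2 sqrtCK.
Qed.

Variable rho : T -> T.
Hypothesis prho : positive_op rho.
Hypothesis trho : (trace rho < +oo)%E.

Let rho_mass0 j : (0 <= mass e rho j)%E.
Proof. exact: mass_ge0. Qed.

Let wordconst0 s j i : 0 <= wordconst G s j i.
Proof. by case: (wordE G s j i). Qed.

(** The first step taken is the rightmost factor of the product, hence [rev]: appending a step to
    the walk prepends a letter to the word. *)
Lemma evolution ks : let X := foldl (fun X k => M k X) rho ks in
  [/\ positive_op X, (trace X < +oo)%E, ks != [::] -> block_diag e X &
      forall i, mass e X i =
        \esum_(j in [set: idx D]) ((wordconst G (rev ks) j i)%:E * mass e rho j)%E].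
Proof.
elim/last_ind: ks => [|ks k /= [pX tX _ mX]].
  split=> // i; rewrite -[LHS](@esum_if_eq _ _ i)//.
  apply: eq_esum => j _; rewrite /wordconst /= mcoeffU eq_sym.
  by case: eqP => [->|_]; rewrite ?mul1e ?mul0e.
rewrite foldl_rcons; have [pY tY bY mY] := M_step k pX tX.
split=> // i; rewrite mY; under eq_esum do rewrite mX.
transitivity (\esum_(l in [set: idx D]) \esum_(j in [set: idx D])
    ((rstrconst G k l i * wordconst G (rev ks) j l)%:E * mass e rho j)%E).
  apply: eq_esum => l _; rewrite -esumZ ?rstrconst_ge0//.
    by apply: eq_esum => j _; rewrite EFinM muleA.
  by move=> j; rewrite mule_ge0 ?lee_fin.
rewrite esum_exchange; last first.
  by move=> l j; rewrite mule_ge0 ?lee_fin// mulr_ge0 ?rstrconst_ge0.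
apply: eq_esum => j _; rewrite rev_rcons wordconst_cons -sumEFin ge0_sume_distrl.
  apply: esum_finsupp => l.
    by rewrite mule_ge0 ?lee_fin// mulr_ge0 ?rstrconst_ge0.
  by move=> h; rewrite wordconst_out// mulr0 mul0e.
by move=> l _; rewrite lee_fin mulr_ge0 ?rstrconst_ge0.
Qed.

Lemma dist_evolution ks i : ks != [::] ->
  dist e (foldl (fun X k => M k X) rho ks) i =
  dist e (\sum_(m \in [set: idx D]) multiconst G (rev ks) m *: M m rho) i.
Proof.
move=> ks0; have /= [pX tX bX mX] := evolution ks.
rewrite dist_mass//; last exact: bX.
(* Outside the finite support of the word the coefficients vanish, so the sum over all m runs over
   this support. *)
set s := rev ks; pose A := msupp (word G s (hx R (idx0 D))).
have -> : \sum_(m \in [set: idx D]) multiconst G s m *: M m rho =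
    \sum_(m <- A) (wordconst G s (idx0 D) m)%:C%C *: M m rho.
  rewrite (fsbigTE A) => [|m mA].
    by apply: eq_bigr => m _; rewrite -(proj1 (wordE G s _ m)).
  by rewrite /multiconst mcoeff_outdom// scale0r.
have st m := M_step m prho trho.
have pM m : positive_op (M m rho) by case: (st m).
rewrite dist_mass//; first last.
- by apply: block_diag_lincomb => m; case: (st m).
- by apply: trace_lincomb => // m; case: (st m).
- exact: pos_lincomb.
rewrite mass_lincomb// mX.
(* The finite sum of series is merged into one series over j, to which [wordconst_multi] applies
   term by term. *)
transitivity (\sum_(m <- A) \esum_(j in [set: idx D])
    ((wordconst G s (idx0 D) m * rstrconst G m j i)%:E * mass e rho j)%E)%E; last first.
  apply: eq_bigr => m _; have [_ _ _ ->] := st m.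
  rewrite -esumZ => [||j]; rewrite ?mule_ge0 ?lee_fin ?rstrconst_ge0//.
  by apply: eq_esum => j _; rewrite EFinM muleA.
rewrite -esum_sum => [|j m _ _]; last first.
  by rewrite mule_ge0 ?lee_fin ?mulr_ge0 ?rstrconst_ge0.
apply: eq_esum => j _; rewrite wordconst_multi -sumEFin ge0_sume_distrl// => m _.
by rewrite lee_fin mulr_ge0 ?rstrconst_ge0.
Qed.

End Evolution.

Unset Implicit Arguments.

Theorem corollary5p3 (R : realType) (D : distset) (G : hypergroup R D)
    (H K : hilbertType R) (T : htensor H K) (e : idx D -> K)
    (U : idx D -> idx D -> idx D -> H -> H)
    (hH : separable_space H) (he : onbasis_family e)
    (hU : forall i j k, isometry_op (U i j k))
    (rho : T -> T) (hrho : is_state rho)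
    (n : nat) (hn : (2 <= n)%N) (ks : n.-tuple (idx D)) :
  let M := oqrw e (hypergroup_B G U) in
  dist e (foldl (fun X k => M k X) rho ks) =
  dist e (\sum_(m \in [set: idx D]) multiconst G (rev ks) m *: M m rho).
Proof.
have [_ prho trho1] := hrho.
apply/funext => i; apply: dist_evolution => //; first by rewrite trho1 ltry.
by rewrite -size_eq0 size_tuple; case: n hn ks.
Qed.
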